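(* Let $n\in\mathbb{N}$ and let $\gamma$ be a Lie series in $\mathcal{D}$ such that $\gamma_m\in\mathcal{P}_m$ for all odd $m$. For a partition $p$ of $n$ put $\Lambda^p:=\mathcal{D}_n\gamma_p$. Then $$\mathsf{Rad}_{\mathcal{P}_n}\Lambda^p=\ker c\cap\Lambda^p=\mathsf{Rad}_{\mathcal{D}_n}\Lambda^p$$ for all odd partitions $p$ of $n$. In particular, $$\mathsf{Rad}\,\mathcal{P}_n=\bigoplus_{p}\mathsf{Rad}_{\mathcal{P}_n}\Lambda^p=\ker c|_{\mathcal{P}_n}=\big\langle\{\gamma_q-\gamma_p\mid p\text{ an odd partition of }n,\ q\approx p\}\big\rangle_K,$$ where the direct sum is over all odd partitions $p$ of $n$, and $\mathcal{P}_n/\mathsf{Rad}\,\mathcal{P}_n$ is commutative and of dimension equal to the number of odd partitions of $n$.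
   Context: $K$ is a field of characteristic $0$. Permutations act on the right ($i\pi$ is the image of $i$) and products in $S_n$ are read from left to right. For $\pi\in S_n$: $\mathrm{Des}(\pi)=\{1\le i\le n-1\mid i\pi>(i+1)\pi\}$, $\mathrm{Peak}(\pi)=\{2\le i\le n-1\mid (i-1)\pi<i\pi>(i+1)\pi\}$. For $D\subseteq\{1,\ldots,n-1\}$ let $\Delta^D=\sum_{\mathrm{Des}(\pi)=D}\pi$ and $\Xi^D=\sum_{E\subseteq D}\Delta^E$; $\mathcal{D}_n$ is the span of the $\Delta^D$ (a subalgebra of $KS_n$), $\mathcal{D}=\bigoplus_{n\ge0}\mathcal{D}_n$. For a word $q=q_1.\cdots.q_k$ of positive integers with sum $n$: $D(q)=\{q_1,q_1+q_2,\ldots,q_1+\cdots+q_{k-1}\}$, $\Delta^q=\Delta^{D(q)}$, $\Xi^q=\Xi^{D(q)}$; $q\approx p$ means $q$ is a rearrangement of $p$. The outer product on $\mathcal{D}$ is $\Xi^r\star\Xi^q=\Xi^{r.q}$ (concatenation). $\mathcal{P}_n\subseteq\mathcal{D}_n$ is the span of the elements $\sum_{\mathrm{Peak}(\pi)=P}\pi$, $P\subseteq\{2,\ldots,n-1\}$; it is a left ideal of $\mathcal{D}_n$, hence an algebra (in general without identity). Let $\omega_n=\sum_{k=0}^{n-1}(-1)^k\Delta^{1^{.k}.(n-k)}$, where $1^{.k}$ is the word of $k$ letters $1$. An idempotent $\alpha\in KS_n$ is a Lie idempotent if $\alpha KS_n=\omega_nKS_n$. A Lie series in $\mathcal{D}$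 is a map $\gamma:\mathbb{N}\to\mathcal{D}$, $m\mapsto\gamma_m\in\mathcal{D}_m$, such that $\frac1m\gamma_m$ is a Lie idempotent for all $m\in\mathbb{N}$; for $q=q_1.\cdots.q_k$, $\gamma_q=\gamma_{q_1}\star\cdots\star\gamma_{q_k}$. A partition of $n$ is a weakly decreasing word of positive integers with sum $n$; it is odd if all parts are odd. $c$ is Solomon's epimorphism: let $\mathsf{char}_q$ be the characteristic function of the class of $S_n$ of cycle type $q$ (up to rearrangement), $q?=\prod_ia_i!\,i^{a_i}$ ($a_i$ the multiplicity of $i$ in $q$), $\mathsf{ch}_q=q?\,\mathsf{char}_q$, and let $\bullet$ be the product on $\bigoplus_n\mathrm{Cl}_K(S_n)$ (class functions) with $\mathsf{ch}_r\bullet\mathsf{ch}_q=\mathsf{ch}_{r.q}$; then $c:(\mathcal{D},\star)\to(\bigoplus_n\mathrm{Cl}_K(S_n),\bullet)$ is the algebra homomorphism sending $\Xi^n$ to the trivial character of $S_n$ for all $n$. For a finite-dimensional $K$-algebra $A$ (not necessarily with identity) and an $A$-left module $M$, $\mathsf{Rad}_AM$ is the intersection of all maximal $A$-submodules of $M$, and $\mathsf{Rad}\,A=\mathsf{Rad}_AA$ is the Jacobson radical. $\langle\cdot\rangle_K$ denotes linear span. *)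

(* Defs.v *)
From HB Require Import structures.
From mathcomp Require Import all_boot all_order all_algebra all_fingroup all_field.
From mathcomp Require Import boolp.

Set Implicit Arguments.
Unset Strict Implicit.
Unset Printing Implicit Defensive.

Import GRing.Theory.
Local Open Scope ring_scope.

(* The group algebra K[G]: the vector space of functions G -> K with the
   convolution product. An alias of {ffun G -> K^o} is needed because the
   latter already carries the pointwise ring structure. *)
Definition galg (K : fieldType) (gT : finGroupType) := {ffun gT -> K^o}.

Section GroupAlgebra.
Variables (K : fieldType) (gT : finGroupType).
Local Notation A := (galg K gT).

HB.instance Definition _ := Vector.copy A {ffun gT -> K^o}.

Definition galg_elt (s : gT) : A := [ffun t => (t == s)%:R : K^o].
Definition galg_mul (a b : A) : A :=
  [ffun s => (\sum_t (a t : K) * b (t^-1 * s)%g) : K^o].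

Lemma galg_mulA : associative galg_mul.
Proof.
move=> a b c; apply/ffunP=> s; rewrite !ffunE.
transitivity (\sum_u \sum_t (a u : K) * (b (u^-1 * t)%g * c (t^-1 * s)%g)).
  apply: eq_bigr => u _; rewrite ffunE mulr_sumr.
  rewrite (reindex_inj (mulgI u^-1%g)) /=; apply: eq_bigr => t _.
  by rewrite invMg invgK -!mulgA mulKVg.
rewrite exchange_big; apply: eq_bigr => t _; rewrite ffunE mulr_suml.
by apply: eq_bigr => u _; rewrite mulrA.
Qed.

Lemma galg_mul1l : left_id (galg_elt 1%g) galg_mul.
Proof.
move=> a; apply/ffunP=> s; rewrite ffunE (bigD1 1%g) //= ffunE eqxx mul1r.
rewrite invg1 mul1g big1 ?addr0 // => t /negPf nt.
by rewrite ffunE nt mul0r.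
Qed.

Lemma galg_mul1r : right_id (galg_elt 1%g) galg_mul.
Proof.
move=> a; apply/ffunP=> s; rewrite ffunE (bigD1 s) //= ffunE mulVg eqxx mulr1.
rewrite big1 ?addr0 // => t nt.
by rewrite ffunE -eq_mulVg1 (negPf nt) mulr0.
Qed.

Lemma galg_mulDl : left_distributive galg_mul +%R.
Proof.
move=> a b c; apply/ffunP=> s; rewrite !ffunE -big_split; apply: eq_bigr => t _.
by rewrite ffunE; apply: mulrDl.
Qed.

Lemma galg_mulDr : right_distributive galg_mul +%R.
Proof.
move=> a b c; apply/ffunP=> s; rewrite !ffunE -big_split; apply: eq_bigr => t _.
by rewrite ffunE; apply: mulrDr.
Qed.

Lemma galg_1neq0 : galg_elt 1%g != 0 :> A.
Proof.
apply/eqP=> /ffunP/(_ 1%g); rewrite !ffunE eqxx; apply/eqP.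
exact: (oner_neq0 K).
Qed.

HB.instance Definition _ := GRing.Zmodule_isNzRing.Build A
  galg_mulA galg_mul1l galg_mul1r galg_mulDl galg_mulDr galg_1neq0.

Lemma galg_scaleAl (k : K) (a b : A) : k *: (a * b) = k *: a * b.
Proof.
apply/ffunP=> s; rewrite !ffunE scaler_sumr; apply: eq_bigr => t _.
by rewrite ffunE; apply: mulrA.
Qed.

Lemma galg_scaleAr (k : K) (a b : A) : k *: (a * b) = a * (k *: b).
Proof.
apply/ffunP=> s; rewrite !ffunE scaler_sumr; apply: eq_bigr => t _.
by rewrite ffunE; apply: mulrCA.
Qed.

HB.instance Definition _ := GRing.Lmodule_isLalgebra.Build K A galg_scaleAl.
HB.instance Definition _ := GRing.Lalgebra_isAlgebra.Build K A galg_scaleAr.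
HB.instance Definition _ := Algebra_isFalgebra.Build K A.

End GroupAlgebra.

Section Intersection.
Variables (K : fieldType) (V : vectType K) (F : {vspace V} -> Prop).

Lemma bigcapv_exists :
  exists R : {vspace V}, forall v, v \in R <-> (forall U, F U -> v \in U).
Proof.
suff H d (R : {vspace V}) : (\dim R <= d)%N ->
    (forall v, (forall U, F U -> v \in U) -> v \in R) ->
    exists R' : {vspace V}, forall v, v \in R' <-> (forall U, F U -> v \in U).
  by apply: (H _ fullv (leqnn _)) => v _; apply: memvf.
elim: d R => [|d IHd] R leRd FR.
all: have [allR|/existsNP[U /not_implyP[FU nRU]]] :=
  pselect (forall U, F U -> (R <= U)%VS).
- by exists R => v; split=> [vR U /allR/subvP->|/FR].
- by case: nRU; move: leRd; rewrite leqn0 dimv_eq0 => /eqP->; apply: sub0v.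
- by exists R => v; split=> [vR U /allR/subvP->|/FR].
- apply: (IHd (R :&: U)%VS) => [|v vF]; last by rewrite memv_cap FR //= vF.
  rewrite -ltnS (leq_trans _ leRd) // ltnNge; apply/negP => leR; apply: nRU.
  by apply/capv_idPl/eqP; rewrite eqEdim capvSl.
Qed.

Definition bigcapv : {vspace V} := projT1 (cid bigcapv_exists).

Lemma memv_bigcap v : v \in bigcapv <-> (forall U, F U -> v \in U).
Proof. exact: (projT2 (cid bigcapv_exists)). Qed.

End Intersection.

(* Here A is a subspace of the algebra aT closed under products (not
   necessarily containing 1), acting by left multiplication on subspaces M
   of aT with A * M <= M. *)
Section Radical.
Variables (K : fieldType) (aT : falgType K).
Implicit Types A M U : {vspace aT}.

Definition submodule A M U := (U <= M)%VS /\ (A * U <= U)%VS.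

Definition maximal_submodule A M U :=
  [/\ submodule A M U, U <> M &
      forall U', submodule A M U' -> (U <= U')%VS -> U' = U \/ U' = M].

(* The leading M only matters when M has no maximal submodule. *)
Definition Rad_mod A M : {vspace aT} := (M :&: bigcapv (maximal_submodule A M))%VS.

Definition Rad A := Rad_mod A A.

End Radical.

Definition is_composition n (q : seq nat) := all (leq 1) q && (sumn q == n).

Definition compositions n : seq (seq nat) :=
  [seq q <- [seq map val (bseqval b) | b : n.-bseq 'I_n.+1] | is_composition n q].

Lemma mem_compositions n q : (q \in compositions n) = is_composition n q.
Proof.
rewrite mem_filter andb_idr // => /andP[q_gt0 /eqP q_sum].
have szq : (size q <= n)%N.
  rewrite -q_sum; elim: q q_gt0 {q_sum} => //= a q IHq /andP[a_gt0 /IHq].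
  by move=> le; rewrite -add1n leq_add.
have leq_n a : a \in q -> (a < n.+1)%N.
  rewrite ltnS -q_sum; elim: q {q_gt0 q_sum szq} => //= b q IHq.
  rewrite inE => /predU1P[->|/IHq/leq_trans->//]; first exact: leq_addr.
  exact: leq_addl.
have szq' : (size (map (@inord n) q) <= n)%N by rewrite size_map.
apply/imageP; exists (Bseq szq') => //=; rewrite -map_comp map_id_in // => a aq.
by rewrite /= inordK ?leq_n.
Qed.

Lemma compositions_uniq n : uniq (compositions n).
Proof.
apply/filter_uniq; rewrite map_inj_uniq ?enum_uniq // => b b'.
by move=> /(inj_map val_inj)/val_inj.
Qed.

Definition partitions n := [seq p <- compositions n | sorted geq p].
Definition odd_partitions n := [seq p <- partitions n | all odd p].

(* Given a family b that is linearly independent on ws, lin_ext ws b f is the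
   linear map on the span of { b w | w in ws } with b w |-> f w. *)
Section LinearExtension.
Variables (K : fieldType) (V U : vectType K) (ws : seq (seq nat)).
Variables (b : seq nat -> V) (f : seq nat -> U).

Definition lin_ext (x : V) : U :=
  \sum_(i < size ws)
    coord (map_tuple b (in_tuple ws)) i x *: f (tnth (in_tuple ws) i).

Lemma lin_ext_is_linear : linear lin_ext.
Proof.
move=> k x y; rewrite /lin_ext scaler_sumr -big_split; apply: eq_bigr => i _.
by rewrite linearP scalerDl scalerA.
Qed.

HB.instance Definition _ := GRing.isLinear.Build K V U _ lin_ext lin_ext_is_linear.

Lemma lin_ext_basis w : free (map b ws) -> w \in ws -> lin_ext (b w) = f w.
Proof.
move=> fr w_in; have lt_w : (index w ws < size ws)%N by rewrite index_mem.
rewrite /lin_ext (bigD1 (Ordinal lt_w)) //= big1 ?addr0 => [|i ni].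
  have {1}-> : b w = (map_tuple b (in_tuple ws))`_(Ordinal lt_w).
    by rewrite (nth_map w) ?nth_index.
  by rewrite coord_free // eqxx scale1r (tnth_nth w) /= nth_index.
have -> : b w = (map_tuple b (in_tuple ws))`_(Ordinal lt_w).
  by rewrite (nth_map w) ?nth_index.
by rewrite coord_free // eq_sym (negPf ni) scale0r.
Qed.

End LinearExtension.

Section Graded.
Variables (K : fieldType) (V : nat -> vectType K).

(* The bilinear product V_k x V_l -> V_(k+l) with b r, b q |-> b (r ++ q),
   where the b q, q in ws n, are linearly independent in V_n. *)
Definition concat_prod (ws : nat -> seq (seq nat))
    (b : forall n, seq nat -> V n) k l (x : V k) (y : V l) : V (k + l)%N :=
  lin_ext (ws k) (b k)
    (fun r => lin_ext (ws l) (b l) (fun q => b (k + l)%N (r ++ q)) y) x.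

Fixpoint word_prod (op : forall k l, V k -> V l -> V (k + l)%N) (one : V 0%N)
    (g : forall m, V m) (q : seq nat) : V (sumn q) :=
  if q is a :: q' then op a (sumn q') (g a) (word_prod op one g q') else one.

(* The degree n component of a homogeneous element of the direct sum of the
   V_m; in particular the transport of x along m = n when that holds. *)
Definition component n m (x : V m) : V n :=
  if @eqP _ m n is ReflectT e then ecast k (V k) e x else 0.

End Graded.

(* The integers 1, ..., n of the mathematical text are shifted to 0, ..., n-1
   as points on which 'S_n acts (so that j corresponds to ord_pred j, the
   point j-1, for 0 < j < n), but are kept unshifted as members of
   Des, Peak and of descent sets D, i.e. D : {set 'I_n} stands for a subset
   of {1, ..., n-1} and 0 is never in Des, Peak. The product of 'S_n already
   is the left-to-right one. *)
Section Descents.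
Variables (K : fieldType) (n : nat).
Local Notation KS := (galg K 'S_n).

Definition Des (s : 'S_n) : {set 'I_n} :=
  [set i : 'I_n | (0 < i)%N && (s i < s (ord_pred i))%N].

Definition Peak (s : 'S_n) : {set 'I_n} :=
  [set i : 'I_n | [&& (1 < i)%N, (s (ord_pred (ord_pred i)) < s (ord_pred i))%N
                    & (s i < s (ord_pred i))%N]].

Definition Delta_set (D : {set 'I_n}) : KS :=
  \sum_(s : 'S_n | Des s == D) galg_elt K s.

Definition Xi_set (D : {set 'I_n}) : KS :=
  \sum_(E : {set 'I_n} | E \subset D) Delta_set E.

Definition Peak_sum (P : {set 'I_n}) : KS :=
  \sum_(s : 'S_n | Peak s == P) galg_elt K s.

Definition descent_alg : {vspace KS} :=
  <<[seq Delta_set D | D : {set 'I_n}]>>%VS.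

Definition peak_alg : {vspace KS} :=
  <<[seq Peak_sum P | P : {set 'I_n}]>>%VS.

Definition word_set (q : seq nat) : {set 'I_n} :=
  [set i : 'I_n | val i \in [seq sumn (take k q) | k <- iota 1 (size q).-1]].

Definition Delta (q : seq nat) : KS := Delta_set (word_set q).
Definition Xi (q : seq nat) : KS := Xi_set (word_set q).

Definition omega : KS :=
  \sum_(k < n) (-1) ^+ k *: Delta (rcons (nseq k 1%N) (n - k)%N).

Definition Lie_idempotent (a : KS) :=
  a * a = a /\ (<[a]> * fullv = <[omega]> * fullv)%VS.

End Descents.

Section OuterProduct.
Variable K : fieldType.
Local Notation KS n := (galg K 'S_n).

Definition outer_prod k l : KS k -> KS l -> KS (k + l)%N :=
  @concat_prod K (fun n => KS n) compositions (Xi K) k l.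

Definition Lie_series (gamma : forall m, KS m) :=
  forall m, (0 < m)%N ->
    gamma m \in descent_alg K m /\ Lie_idempotent (m%:R^-1 *: gamma m).

Definition gamma_word (gamma : forall m, KS m) n (q : seq nat) : KS n :=
  component (V := fun n => KS n) n
    (word_prod (V := fun n => KS n) outer_prod (Xi K 0 [::]) gamma q).

End OuterProduct.

(* Class functions are elements of {ffun 'S_n -> K^o}; the product below only
   is meaningful on the span of the ch q, i.e. on class functions. *)
Section ClassFunctions.
Variable K : fieldType.
Local Notation CF n := {ffun 'S_n -> K^o}.

Definition cycle_type n (s : 'S_n) : seq nat :=
  [seq #|(C : {set _})| | C <- enum (porbits s)].

Definition char_fun n (q : seq nat) : CF n :=
  [ffun s => (perm_eq (cycle_type s) q)%:R : K^o].

Definition word_factor (q : seq nat) : nat :=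
  (\prod_(i <- undup q) ((count_mem i q)`! * i ^ count_mem i q))%N.

Definition ch n (q : seq nat) : CF n := (word_factor q)%:R *: char_fun n q.

Definition cf_prod k l : CF k -> CF l -> CF (k + l)%N :=
  @concat_prod K (fun n => CF n) partitions ch k l.

Definition triv_char n : CF n := [ffun=> 1 : K^o].

(* Solomon's epimorphism in degree n: the linear map on D_n with
   Xi^q |-> triv_(q_1) . ... . triv_(q_k). *)
Definition solomon n : galg K 'S_n -> CF n :=
  lin_ext (compositions n) (Xi K n)
    (fun q => component (V := fun n => CF n) n
       (word_prod (V := fun n => CF n) cf_prod (ch 0 [::]) triv_char q)).

Definition ker_solomon n : {vspace galg K 'S_n} :=
  (descent_alg K n :&: lker (linfun (@solomon n)))%VS.

End ClassFunctions.

(* Main.v *)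
(* Write a permutation s as the word s(1)...s(n). An element x of D_n depends only
   on the relative order of letters, so it is a function on words; then the outer
   product of x and y is w |-> x(prefix of w) y(suffix of w), and Xi^r x at w is
   the sum of x over the shuffles of the consecutive blocks of w of lengths r. Since omega_m is (up to sign) a
   convolution of the alternating decreasing and the increasing word functions,
   it is annihilated by proper shuffles, hence so is gamma_m; as deconcatenation
   is a morphism for the shuffle product, Xi^r gamma_p is a sum of gamma_t, t ~ p,
   which vanishes if r is longer than p and is a positive multiple of gamma_r if
   r ~ p. Together with gamma_q = (nonzero) Xi^q + (longer words) this yields

     gamma_q gamma_p = u_q gamma_q  with u_q <> 0    if q ~ p,
     gamma_q gamma_p = 0   if q is at least as long as p and q is not ~ p,

   and the gamma_q form a basis of D_n. It follows that the sum of coefficients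
   on each class of ~ behaves like a character, and that the elements of Lambda^p
   with coefficient sum 0 form the unique maximal submodule. The gamma_q with q
   odd lie in P_n because peaks are local; they span it because the possible
   peak sets inject into the odd compositions. Finally c is composed with the
   injective homomorphism ch_p |-> prod_i X^(N^(p_i)), N > n, to K[X], under
   which gamma_p has degree sum_i N^(p_i), so that the kernel of c on P_n is the
   set of elements all of whose class sums vanish. *)
Require Import Defs.
From HB Require Import structures.
From mathcomp Require Import all_boot all_order all_algebra all_fingroup all_field.

Set Implicit Arguments.
Unset Strict Implicit.
Unset Printing Implicit Defensive.

Import GRing.Theory.
Local Open Scope ring_scope.

(** * Shuffles and deconcatenation *)

(** No structure constant is computed. The coefficient of Xi^m in gamma_m and the multiplicities of
    merged words enter only through being nonzero, and of c(gamma_m) only the degree of its image in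
    K[X] is found. This suffices because all later statements reduce to the vanishing of class sums.
    Factors of the word of a permutation are no longer words of permutations, so the calculus is
    carried out for functions on arbitrary words of distinct letters; [standardization] is the way
    back. P_n may lack an identity, so its radical is found directly from the maximal submodules.
    The class sums have maximal submodules of P_n as kernels. Conversely, let U be a maximal
    submodule and N the part of Lambda^p with class sum 0. If U does not contain N, then U + N = P_n
    contains gamma_p, so U has an element of Lambda^p with class sum 1; multiplying it by the
    gamma_t, t ~ p, puts all of Lambda^p into U, a contradiction. *)

Fixpoint shuffle (u v : seq nat) {struct u} : seq (seq nat) :=
  if u is a :: u' then
    (fix shuffle_u v := if v is b :: v' then
       map (cons a) (shuffle u' v) ++ map (cons b) (shuffle_u v') else [:: u]) v
  else [:: v].

Fixpoint mshuffle (us : seq (seq nat)) : seq (seq nat) :=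
  if us is u :: us' then flatten [seq shuffle u z | z <- mshuffle us'] else [:: [::]].

Lemma shuffleC0 u : shuffle u [::] = [:: u].
Proof. by case: u. Qed.

Lemma shuffle_cons a u b v :
  shuffle (a :: u) (b :: v) =
  map (cons a) (shuffle u (b :: v)) ++ map (cons b) (shuffle (a :: u) v).
Proof. by []. Qed.

(** The recursion of [shuffle] shortens either of the two words; this is the matching induction. *)
Lemma shuffle_ind (P : seq nat -> seq nat -> Prop) :
  (forall v, P [::] v) -> (forall u, P u [::]) ->
  (forall a u b v, P u (b :: v) -> P (a :: u) v -> P (a :: u) (b :: v)) ->
  forall u v, P u v.
Proof.
move=> P0l P0r PS; elim=> [|a u IHu] v; first exact: P0l.
by elim: v => [|b v IHv]; [apply: P0r | apply: PS].
Qed.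

Lemma mem_map_cons (a c : nat) z zs :
  (c :: z \in map (cons a) zs) = (c == a) && (z \in zs).
Proof.
apply/mapP/andP=> [[y yin [-> ->]]|[/eqP-> zin]]; first by rewrite eqxx.
by exists z.
Qed.

Lemma uniq_cons_cat_cons (a b : nat) u v : uniq ((a :: u) ++ b :: v) ->
  [/\ a != b, uniq (u ++ b :: v) & uniq ((a :: u) ++ v)].
Proof.
move=> uq; have /andP[a_n uq1] := uq; split=> //.
  by apply: contraNneq a_n => ->; rewrite mem_cat inE eqxx orbT.
by apply: subseq_uniq uq; rewrite cat_subseq ?subseq_cons.
Qed.

(** As the letters are distinct, the first letter of [z] decides from which word it was taken. In
    this form shuffles will be recognized in [Xi_mulE]. *)
Lemma mem_shuffle u v z : uniq (u ++ v) ->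
  (z \in shuffle u v) = [&& perm_eq z (u ++ v), subseq u z & subseq v z].
Proof.
move: u v z; apply: shuffle_ind => [v|u|a u b v IHu IHv] z.
- rewrite inE sub0seq /= => _.
  apply/eqP/andP=> [->|[pe]]; first by rewrite perm_refl subseq_refl.
  by move=> /size_subseq_leqif[_]; rewrite (perm_size pe) eqxx => /esym/eqP.
- rewrite shuffleC0 cats0 inE sub0seq andbT /= => _.
  apply/eqP/andP=> [->|[pe]]; first by rewrite perm_refl subseq_refl.
  by move=> /size_subseq_leqif[_]; rewrite (perm_size pe) eqxx => /esym/eqP.
move=> uq; have pC : perm_eq ((a :: u) ++ b :: v) (b :: (a :: u) ++ v).
  by rewrite -(cat1s b v) perm_catCA.
have [/negPf neq_ab uq1 uq2] := uniq_cons_cat_cons uq.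
rewrite shuffle_cons mem_cat; case: z => [|c z].
  rewrite andbF; apply/negbTE; rewrite negb_or.
  by apply/andP; split; apply/mapP=> -[].
rewrite !mem_map_cons IHu // IHv // [RHS]/= !(eq_sym _ c).
case: (eqVneq c a) => [->|nca]; first by rewrite neq_ab perm_cons orbF.
case: (eqVneq c b) => [->|ncb]; first by rewrite (permPr pC) perm_cons.
apply/esym/negP=> /and3P[pe s1 s2].
have uz : uniq (c :: z) by rewrite (perm_uniq pe).
have : c \in (a :: u) ++ b :: v by rewrite -(perm_mem pe) inE eqxx.
rewrite mem_cat; move: uz => /= /andP[/negP cz _] /orP[] h; apply: cz.
  exact: (mem_subseq s1).
exact: (mem_subseq s2).
Qed.

Lemma shuffle_uniq u v : uniq (u ++ v) -> uniq (shuffle u v).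
Proof.
have consI a : injective (cons a : seq nat -> _) by move=> x y [].
move: u v; apply: shuffle_ind => [v|u|a u b v IHu IHv] //; first by rewrite shuffleC0.
move=> uq; have [nab uq1 uq2] := uniq_cons_cat_cons uq.
rewrite shuffle_cons cat_uniq !map_inj_uniq // IHu // IHv // andbT /=.
by apply/hasPn=> _ /mapP[z _ ->]; rewrite mem_map_cons eq_sym (negPf nab).
Qed.

(** Since [v] can be recovered from [z], shuffles of [u] with different words are disjoint; this
    gives [mshuffle_uniq]. *)
Lemma mem_shuffle_filter u v z : uniq (u ++ v) -> z \in shuffle u v ->
  v = [seq x <- z | x \notin u].
Proof.
move=> uq; rewrite mem_shuffle // => /and3P[pe _ sv].
have uz : uniq z by rewrite (perm_uniq pe).
move/(subseq_uniqP uz): sv => ->; apply: eq_in_filter => x.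
rewrite (perm_mem pe) mem_cat => xuv.
move: uq; rewrite cat_uniq => /and3P[_ /hasPn dis _].
by case: (boolP (x \in v)) xuv => [/dis/negbTE->//|_]; rewrite orbF => ->.
Qed.

Lemma mem_mshuffle us z : uniq (flatten us) ->
  (z \in mshuffle us) = perm_eq z (flatten us) && all (subseq^~ z) us.
Proof.
elim: us z => [|u us IH] z /=.
  by rewrite inE andbT => _; apply/eqP/perm_nilP.
move=> uq; have uqs : uniq (flatten us) by move: uq; rewrite cat_uniq => /and3P[].
apply/flatten_mapP/and3P=> [[y]|[pe su sus]].
  rewrite IH // => /andP[py sy].
  have puy : perm_eq (u ++ y) (u ++ flatten us) by rewrite perm_cat2l.
  rewrite mem_shuffle ?(perm_uniq puy) // => /and3P[pz su sz]; split=> //.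
    exact: perm_trans pz puy.
  by apply/allP=> x /(allP sy) /subseq_trans; apply.
have uz : uniq z by rewrite (perm_uniq pe).
pose y := [seq x <- z | x \notin u].
have pz : perm_eq z (u ++ y).
  have eu : u = [seq x <- z | x \in u] by apply/(subseq_uniqP uz).
  by rewrite perm_sym {1}eu; exact/permPl/perm_filterC.
have puy : perm_eq (u ++ y) (u ++ flatten us) by rewrite -(permPl pz).
have py : perm_eq y (flatten us) by move: puy; rewrite perm_cat2l.
exists y; last by rewrite mem_shuffle ?(perm_uniq puy) // pz su filter_subseq.
rewrite IH // py; apply/allP=> x xus; move/(allP sus): (xus) => sxz.
rewrite subseq_filter sxz andbT; apply/allP=> a ax.
have : a \in flatten us by apply/flattenP; exists x.
by move: uq; rewrite cat_uniq => /and3P[_ /hasPn dis _] /dis.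
Qed.

Lemma mshuffle_uniq us : uniq (flatten us) -> uniq (mshuffle us).
Proof.
elim: us => [//|u us IH] /= uq.
have uqs : uniq (flatten us) by move: uq; rewrite cat_uniq => /and3P[].
have uqz z : z \in mshuffle us -> uniq (u ++ z).
  rewrite mem_mshuffle // => /andP[pz _].
  have puy : perm_eq (u ++ z) (u ++ flatten us) by rewrite perm_cat2l.
  by rewrite (perm_uniq puy).
move: (IH uqs) uqz; elim: (mshuffle us) => [//|z zs IHz] /= /andP[zn uzs] uqz.
rewrite cat_uniq shuffle_uniq ?uqz ?inE ?eqxx //=; apply/andP; split; last first.
  by apply: IHz => // y yzs; apply: uqz; rewrite inE yzs orbT.
apply/hasPn=> x /flatten_mapP[y yzs xy]; apply/negP=> xz.
have/uqz uy : y \in z :: zs by rewrite inE yzs orbT.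
have/uqz uz : z \in z :: zs by rewrite inE eqxx.
move: zn; rewrite (mem_shuffle_filter uz xz) -(mem_shuffle_filter uy xy).
by rewrite yzs.
Qed.

Section Deconcatenation.
Variable R : comNzRingType.
Implicit Types f g : seq nat -> R.

(** The convolution for deconcatenation. Under [wf] it corresponds to the outer product. *)
Definition cut_prod f g : seq nat -> R :=
  fun z => \sum_(i < (size z).+1) f (take i z) * g (drop i z).

Definition sh u v f : R := \sum_(z <- shuffle u v) f z.

Lemma sh0l v f : sh [::] v f = f v. Proof. by rewrite /sh big_seq1. Qed.
Lemma sh0r u f : sh u [::] f = f u.
Proof. by rewrite /sh shuffleC0 big_seq1. Qed.

Lemma sh_cons a u b v f : sh (a :: u) (b :: v) f =
  sh u (b :: v) (f \o cons a) + sh (a :: u) v (f \o cons b).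
Proof. by rewrite /sh shuffle_cons big_cat !big_map. Qed.

Lemma eq_sh u v f g : f =1 g -> sh u v f = sh u v g.
Proof. by move=> fg; apply: eq_bigr. Qed.

Lemma shD u v f g : sh u v (fun z => f z + g z) = sh u v f + sh u v g.
Proof. exact: big_split. Qed.

Lemma shZ u v c f : sh u v (fun z => c * f z) = c * sh u v f.
Proof. by rewrite /sh mulr_sumr. Qed.

Lemma cut_prod_cons f g a z :
  cut_prod f g (a :: z) = f [::] * g (a :: z) + cut_prod (f \o cons a) g z.
Proof. by rewrite /cut_prod big_ord_recl. Qed.

Lemma cut_prodA f g h : cut_prod (cut_prod f g) h =1 cut_prod f (cut_prod g h).
Proof.
move=> z; elim: z f g h => [|a z IH] f g h.
  by rewrite /cut_prod /= !big_ord1 /= ?big_ord1 /= mulrA.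
rewrite cut_prod_cons [RHS]cut_prod_cons cut_prod_cons -(IH (f \o cons a)) mulrDr
  -addrA.
congr (_ + _); first by rewrite /cut_prod big_ord1 /= mulrA.
rewrite [cut_prod (_ \o _) h z]/cut_prod [cut_prod (g \o _) h z]/cut_prod.
rewrite [cut_prod (cut_prod (f \o _) _) _ _]/cut_prod mulr_sumr -big_split.
by apply: eq_bigr => i _; rewrite /= cut_prod_cons mulrDl mulrA.
Qed.

(** The bialgebra axiom: to cut a shuffle of [u] and [v] is to cut [u] and [v], and to shuffle the
    two left parts and the two right parts separately. *)
Lemma sh_cut_prod u v f g : sh u v (cut_prod f g) =
  \sum_(i < (size u).+1) \sum_(j < (size v).+1)
     sh (take i u) (take j v) f * sh (drop i u) (drop j v) g.
Proof.
move: u v f g; apply: shuffle_ind => [v|u|a u b v IHu IHv] f g.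
- by rewrite big_ord1 sh0l; apply: eq_bigr => j _; rewrite !sh0l.
- by rewrite sh0r; apply: eq_bigr => j _; rewrite big_ord1 !sh0r.
rewrite sh_cons.
have e c : cut_prod f g \o cons c =1
   fun z => f [::] * (g \o cons c) z + cut_prod (f \o cons c) g z.
  by move=> y; rewrite /= cut_prod_cons.
rewrite (eq_sh _ _ (e a)) (eq_sh _ _ (e b)) !shD !shZ addrACA -mulrDr -sh_cons.
rewrite IHu IHv [RHS]big_ord_recl [X in _ = X + _]big_ord_recl /= sh0l -addrA;
  congr (_ + _).
transitivity ((\sum_(i < (size u).+1) f (a :: take i u) * sh (drop i u) (b :: v) g
   + \sum_(j < (size v).+1) f (b :: take j v) * sh (a :: u) (drop j v) g)
   + \sum_(i < (size u).+1) \sum_(j < (size v).+1)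
     sh (a :: take i u) (b :: take j v) f * sh (drop i u) (drop j v) g).
  under eq_bigr do rewrite big_ord_recl /= sh0r /=.
  rewrite big_split /= [X in _ + X = _]big_ord_recl /=.
  under [X in _ + (X + _) = _]eq_bigr do rewrite sh0l /=.
  rewrite addrACA; congr (_ + _).
  rewrite -big_split; apply: eq_bigr => i _; rewrite -big_split.
  by apply: eq_bigr => j _ /=; rewrite -mulrDl -sh_cons.
rewrite (addrC (\sum_(i < _) _)) -addrA; congr (_ + _).
  by apply: eq_bigr => j _; rewrite sh0l.
by rewrite -big_split; apply: eq_bigr => i _; rewrite [RHS]big_ord_recl /= sh0r.
Qed.

End Deconcatenation.

(** * Products of graded functions on words *)

(** Adjacent transpositions generate all rearrangements. This serves to show that counts over
    [splits] do not depend on the order of letters. *)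
Lemma perm_eq_ind (P : seq nat -> seq nat -> Prop) :
  (forall s, P s s) -> (forall s t u, P s t -> P t u -> P s u) ->
  (forall a s t, P s t -> P (a :: s) (a :: t)) ->
  (forall a b s, P (a :: b :: s) (b :: a :: s)) ->
  forall s t, perm_eq s t -> P s t.
Proof.
move=> P1 Pt Pc Ps.
have Pmid a s1 s2 : P (a :: s1 ++ s2) (s1 ++ a :: s2).
  by elim: s1 => [|b s1 IH] //=; apply: Pt (Ps _ _ _) (Pc _ _ _ IH).
elim=> [|a s IH] t; first by rewrite perm_sym => /perm_nilP->.
move=> pst; have at_ : a \in t by rewrite -(perm_mem pst) inE eqxx.
case/splitPr: at_ pst => t1 t2 pst.
apply: Pt (Pmid a t1 t2); apply/Pc/IH.
by rewrite -(perm_cons a) (permPl pst) -cat1s perm_catCA.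
Qed.

Section WordProducts.
Variable R : comNzRingType.
Implicit Types (f g : seq nat -> R) (F : nat -> seq nat -> R).

Fixpoint wprod F (q : seq nat) : seq nat -> R :=
  if q is m :: q' then cut_prod (F m) (wprod F q') else fun z => (z == [::])%:R.

Definition graded F := forall m z, size z != m -> F m z = 0.

Lemma cut_prod_homog f g m z : (forall u, size u != m -> f u = 0) ->
  cut_prod f g z = if (m <= size z)%N then f (take m z) * g (drop m z) else 0.
Proof.
move=> f0; rewrite /cut_prod; case: leqP => lemz.
  rewrite (bigD1 (Ordinal (lemz : (m < (size z).+1)%N))) //= big1 ?addr0 // => i.
  rewrite -val_eqE /= => ni; rewrite f0 ?mul0r // size_takel //.
  by rewrite -ltnS.
rewrite big1 // => i _; rewrite f0 ?mul0r // size_takel -1?ltnS //.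
by rewrite neq_ltn (leq_ltn_trans _ lemz) // -ltnS.
Qed.

Lemma eq_cut_prod f f' g g' : f =1 f' -> g =1 g' -> cut_prod f g =1 cut_prod f' g'.
Proof. by move=> ff gg z; apply: eq_bigr => i _; rewrite ff gg. Qed.

Lemma wprod_homog F q : graded F -> forall z, size z != sumn q -> wprod F q z = 0.
Proof.
move=> gF; elim: q => [|m q IH] z /=; first by rewrite -size_eq0 => /negbTE->.
move=> sz; rewrite (cut_prod_homog _ _ (gF m)); case: ifP => // lemz.
by rewrite IH ?mulr0 // size_drop; apply: contraNN sz => /eqP<-; rewrite subnKC.
Qed.

Lemma wprod_cat F p q : wprod F (p ++ q) =1 cut_prod (wprod F p) (wprod F q).
Proof.
elim: p => [|m p IH] z /=; last by rewrite cut_prodA; apply: eq_cut_prod.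
rewrite (@cut_prod_homog _ _ 0) ?take0 ?drop0 ?mul1r //.
by move=> u; rewrite size_eq0 => /negbTE->.
Qed.

Lemma wprod_catM F p q u v : graded F -> size u = sumn p ->
  wprod F (p ++ q) (u ++ v) = wprod F p u * wprod F q v.
Proof.
move=> gF su; rewrite wprod_cat (cut_prod_homog _ _ (wprod_homog gF)) -su.
by rewrite size_cat leq_addr take_size_cat // drop_size_cat.
Qed.

Definition incr m z : R := ((size z == m) && sorted ltn z)%:R.

Lemma incr_graded : graded incr.
Proof. by move=> m z /negbTE; rewrite /incr => ->. Qed.

Lemma wprod_incr q z :
  wprod incr q z = ((size z == sumn q) && all (sorted ltn) (reshape q z))%:R.
Proof.
elim: q z => [|m q IH] z /=; first by rewrite size_eq0 andbT.
rewrite (cut_prod_homog _ _ (@incr_graded m)) IH /incr; case: leqP => lemz.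
  rewrite size_takel // eqxx -natrM mulnb size_drop /=.
  rewrite -(eqn_add2l m) subnKC //.
  by rewrite andbCA.
rewrite (_ : _ == _ = false) //; apply/negbTE.
by rewrite neq_ltn (leq_trans lemz) // leq_addr.
Qed.

Section Sorted.
Variable r : rel nat.
Hypotheses (r_trans : transitive r) (r_tot : forall a b, a != b -> r a b = ~~ r b a).

(** Among the shuffles of two words of distinct letters, at most one is sorted, namely their merge,
    and only if both words are sorted. The bound [c] on the first letter makes the induction
    work. *)
Lemma sh_path c u v : uniq (u ++ v) ->
  sh u v (fun z => (path r c z)%:R : R) = (path r c u && path r c v)%:R.
Proof.
move: u v c; apply: shuffle_ind => [v|u|a u b v IHu IHv] c uq.
- by rewrite sh0l.
- by rewrite sh0r andbT.
have [nab uq1 uq2] := uniq_cons_cat_cons uq.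
have e d : (fun z => (path r c z)%:R) \o cons d =1
           fun z => (r c d)%:R * (path r d z)%:R : R.
  by move=> z; rewrite /= -natrM mulnb.
rewrite sh_cons !(eq_sh _ _ (e _)) !shZ IHu // IHv // -!natrM !mulnb -natrD /=.
have rba : r b a = ~~ r a b by apply: r_tot; rewrite eq_sym.
move: rba; case rab: (r a b) => /= rba.
  have rcb : r c a -> r c b by move/r_trans; apply.
  by move: rcb; rewrite rba /= !andbF addn0; case: (r c a) => // ->.
have rca : r c b -> r c a by move/r_trans; apply.
by move: rca; rewrite rba !andbF /= add0n; case: (r c b) => [->|] //; rewrite ?andbF.
Qed.

Lemma sh_sorted u v : uniq (u ++ v) ->
  sh u v (fun z => (sorted r z)%:R : R) = (sorted r u)%:R * (sorted r v)%:R.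
Proof.
rewrite -natrM mulnb; case: u => [|a u]; first by rewrite sh0l.
case: v => [|b v]; first by rewrite sh0r andbT.
move=> uq; have [nab uq1 uq2] := uniq_cons_cat_cons uq.
rewrite sh_cons (@eq_sh _ _ _ _ (fun z => (path r a z)%:R)) // sh_path //.
rewrite (@eq_sh _ _ _ _ (fun z => (path r b z)%:R)) // sh_path // -natrD /=.
have rba : r b a = ~~ r a b by apply: r_tot; rewrite eq_sym.
move: rba; case rab: (r a b) => /= rba.
  by rewrite rba /= addn0.
by rewrite rba !andbF /= add0n.
Qed.

End Sorted.

(** * Omega as a convolution of monotone words *)

Definition sgn_decr (z : seq nat) : R := (-1) ^+ size z * (sorted gtn z)%:R.
(** The degree derivation applied to [sgn_decr], which is a left inverse of [increasing] for
    convolution on words of distinct letters. The convolution of [dsgn_decr] with [increasing], a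
    logarithmic derivative, is omega up to sign. *)
Definition dsgn_decr (z : seq nat) : R := (size z)%:R * sgn_decr z.
Definition increasing (z : seq nat) : R := (sorted ltn z)%:R.

Lemma size_shuffle u v z : uniq (u ++ v) -> z \in shuffle u v ->
  size z = (size u + size v)%N.
Proof. by move=> uq; rewrite mem_shuffle // -size_cat => /and3P[/perm_size]. Qed.

Lemma sh_increasing u v : uniq (u ++ v) ->
  sh u v increasing = increasing u * increasing v.
Proof.
move=> uq; rewrite /increasing sh_sorted //; first exact: ltn_trans.
by move=> a b /=; case: ltngtP.
Qed.

Lemma sh_sgn_decr u v : uniq (u ++ v) ->
  sh u v sgn_decr = sgn_decr u * sgn_decr v.
Proof.
move=> uq; rewrite mulrACA -exprD -sh_sorted //; last first.
- by move=> a b /=; case: ltngtP.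
- by move=> b a c /= ab bc; apply: ltn_trans bc ab.
rewrite -shZ /sh; apply: eq_big_seq => z zin.
by rewrite /sgn_decr (size_shuffle uq zin).
Qed.

(** The Leibniz rule: length is additive and [sgn_decr] is multiplicative on shuffles. *)
Lemma sh_dsgn_decr u v : uniq (u ++ v) ->
  sh u v dsgn_decr = dsgn_decr u * sgn_decr v + sgn_decr u * dsgn_decr v.
Proof.
move=> uq; rewrite [dsgn_decr u]/dsgn_decr [dsgn_decr v]/dsgn_decr.
rewrite [sgn_decr u * (_ * _)]mulrCA -[_ * sgn_decr u * _]mulrA -mulrDl -natrD.
rewrite -sh_sgn_decr // -shZ.
by apply: eq_big_seq => z /(size_shuffle uq); rewrite /dsgn_decr => ->.
Qed.

(* The signed sum over cuts into a decreasing and an increasing word telescopes. *)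
Lemma cut_prod_sgn_decr z : uniq z -> z != [::] -> cut_prod sgn_decr increasing z = 0.
Proof.
case: z => // a z uq _; rewrite cut_prod_cons.
suff -> : cut_prod (sgn_decr \o cons a) increasing z = - (path ltn a z)%:R.
  by rewrite /sgn_decr expr0 !mul1r subrr.
elim: z a uq => [|b z IH] a uq.
  by rewrite /cut_prod big_ord1 /= /sgn_decr expr1 !mulr1.
have [nab uz] : a != b /\ uniq (b :: z).
  by move: uq; rewrite cons_uniq inE negb_or => /andP[/andP[]].
rewrite cut_prod_cons {1}/sgn_decr /= expr1 mulr1 mulN1r.
case: ltngtP nab => // ab _ /=.
  rewrite /cut_prod big1 ?addr0 // => i _.
  by rewrite /sgn_decr /= ltnNge (ltnW ab) mulr0 mul0r.
transitivity (- increasing (b :: z) - cut_prod (sgn_decr \o cons b) increasing z).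
  congr (_ + _); rewrite /cut_prod -sumrN; apply: eq_bigr => i _.
  by rewrite /sgn_decr /= ab exprS mulN1r !mulNr.
by rewrite IH // opprK addNr oppr0.
Qed.

(** The usual proof that a logarithmic derivative is primitive: multiplicativity and the Leibniz
    rule leave two terms, each with a factor [cut_prod sgn_decr increasing] at a nonempty word. *)
Lemma sh_omega u v : uniq (u ++ v) -> u != [::] -> v != [::] ->
  sh u v (cut_prod dsgn_decr increasing) = 0.
Proof.
move=> uq u0 v0; have := uq; rewrite cat_uniq => /and3P[uu _ uv].
transitivity (cut_prod dsgn_decr increasing u * cut_prod sgn_decr increasing v
            + cut_prod sgn_decr increasing u * cut_prod dsgn_decr increasing v).
  rewrite sh_cut_prod /cut_prod !big_distrlr -big_split; apply: eq_bigr => i _ /=.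
  rewrite -big_split; apply: eq_bigr => j _ /=.
  have uqt : uniq (take i u ++ take j v).
    by apply: subseq_uniq uq; apply: cat_subseq; apply: take_subseq.
  have uqd : uniq (drop i u ++ drop j v).
    by apply: subseq_uniq uq; apply: cat_subseq; apply: drop_subseq.
  rewrite sh_dsgn_decr // sh_increasing // mulrDl.
  by congr (_ + _); rewrite mulrACA.
by rewrite !cut_prod_sgn_decr // mulr0 mul0r addr0.
Qed.

(** If [z] falls to its letter at position k and rises from there, exactly the cuts at k and k+1
    contribute, and k(-1)^k + (k+1)(-1)^(k+1) = -(-1)^k. On all other words both sides are 0. *)
Lemma cut_prod_dsgn_decr z : uniq z -> z != [::] ->
  - cut_prod dsgn_decr increasing z =
  \sum_(k < size z) (-1) ^+ k *
     (sorted gtn (take k.+1 z) && sorted ltn (drop k z))%:R.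
Proof.
case: z => // a z uq _; elim: z a uq => [|b z IH] a uq.
  rewrite big_ord1 cut_prod_cons /cut_prod big_ord1 /dsgn_decr /sgn_decr /=.
  by rewrite !mul0r add0r !mul1r !mulr1 opprK.
have [nab uz] : a != b /\ uniq (b :: z).
  by move: uq; rewrite cons_uniq inE negb_or => /andP[/andP[]].
rewrite cut_prod_cons {1}/dsgn_decr /= mul0r mul0r add0r.
rewrite [RHS]big_ord_recl cut_prod_cons {1}/dsgn_decr /sgn_decr /= expr1 expr0.
rewrite !mul1r !mulr1 mulN1r opprD opprK.
case: ltngtP nab => // ab _ /=.
  rewrite ?take0 /cut_prod !big1 ?addr0 ?oppr0 ?addr0 // => i _.
    by rewrite mulr0.
  by rewrite /dsgn_decr /sgn_decr /= ltnNge (ltnW ab) /= !mulr0 mul0r.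
rewrite add0r; transitivity (cut_prod dsgn_decr increasing (b :: z)
    + cut_prod sgn_decr increasing (b :: z)).
  rewrite (cut_prod_cons dsgn_decr) (cut_prod_cons sgn_decr) [dsgn_decr [::]]mul0r.
  rewrite mul0r add0r (_ : sgn_decr [::] = 1) ?mul1r 1?addrCA; last first.
    by rewrite /sgn_decr expr0 mulr1.
  congr (_ + _); rewrite /cut_prod -big_split -sumrN; apply: eq_bigr => i _ /=.
  rewrite /dsgn_decr /sgn_decr /= ab -mulrDl -mulNr; congr (_ * _).
  rewrite andTb [(-1) ^+ (_.+2)]exprS mulN1r !mulNr mulrN opprK.
  by rewrite -[(size _).+2%:R]natr1 mulrDl mul1r.
rewrite cut_prod_sgn_decr // addr0 -[LHS]opprK IH // -sumrN; apply: eq_bigr => i _.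
by rewrite exprS mulN1r mulNr.
Qed.

(** * Coproducts of products of primitive functions *)

Fixpoint splits (p : seq nat) : seq (seq nat * seq nat) :=
  if p is m :: p' then
    [seq (m :: x.1, x.2) | x <- splits p'] ++ [seq (x.1, m :: x.2) | x <- splits p']
  else [:: ([::], [::])].

Definition primitive F := forall m u v,
  uniq (u ++ v) -> u != [::] -> v != [::] -> sh u v (F m) = 0.

(** A primitive factor goes wholly to [u] or wholly to [v], whence one term for each distribution of
    the letters of [p]. Positivity of the letters makes each [F m] vanish on the empty word. *)
Lemma sh_wprod F p u v : graded F -> primitive F -> all (leq 1) p -> uniq (u ++ v) ->
  sh u v (wprod F p) = \sum_(x <- splits p) wprod F x.1 u * wprod F x.2 v.
Proof.
move=> gF pF; elim: p u v => [|m p IH] u v /=.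
  move=> _ uq; rewrite big_seq1 /= -natrM mulnb; case: u uq => [|a u] uq.
    by rewrite sh0l.
  rewrite /sh big1_seq // => z /(size_shuffle uq).
  by case: z.
case/andP=> m0 p0 uq; rewrite sh_cut_prod big_cat !big_map /=.
have F0 : F m [::] = 0 by rewrite gF // neq_ltn m0.
have uqd i j : uniq (drop i u ++ drop j v).
  by apply: subseq_uniq uq; apply: cat_subseq; apply: drop_subseq.
have uqt i j : uniq (take i u ++ take j v).
  by apply: subseq_uniq uq; apply: cat_subseq; apply: take_subseq.
transitivity (\sum_(i < (size u).+1) F m (take i u) * sh (drop i u) v (wprod F p) +
              \sum_(j < (size v).+1) F m (take j v) * sh u (drop j v) (wprod F p)).
  rewrite big_ord_recl big_ord_recl /= !take0 !drop0 sh0l F0 mul0r add0r addrC.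
  rewrite [X in _ = X + _]big_ord_recl [X in _ = _ + X]big_ord_recl /=.
  rewrite !take0 F0 !mul0r !add0r.
  congr (_ + _); last by apply: eq_bigr => j _; rewrite sh0l.
  apply: eq_bigr => i _; rewrite big_ord_recl /= take0 drop0 sh0r big1 ?addr0 //.
  move=> j _; rewrite pF ?mul0r //.
    by case: (u) i => [[]|].
  by case: (v) j => [[]|].
have IHu i : sh (drop i u) v (wprod F p) =
    \sum_(x <- splits p) wprod F x.1 (drop i u) * wprod F x.2 v.
  by apply: IH => //; rewrite -[v]drop0.
have IHv j : sh u (drop j v) (wprod F p) =
    \sum_(x <- splits p) wprod F x.1 u * wprod F x.2 (drop j v).
  by apply: IH => //; rewrite -[u]drop0.
congr (_ + _).
  under [LHS]eq_bigr do rewrite IHu mulr_sumr.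
  rewrite exchange_big; apply: eq_bigr => x _; rewrite [in RHS]/cut_prod mulr_suml.
  by apply: eq_bigr => i _; rewrite mulrA.
under [LHS]eq_bigr do rewrite IHv mulr_sumr.
rewrite exchange_big; apply: eq_bigr => x _; rewrite [in RHS]/cut_prod mulr_sumr.
by apply: eq_bigr => i _; rewrite mulrCA.
Qed.

Lemma mem_splits p x : x \in splits p -> perm_eq (x.1 ++ x.2) p.
Proof.
elim: p x => [|m p IH] x /=; first by rewrite inE => /eqP->.
rewrite mem_cat => /orP[] /mapP[y /IH py -> /=]; first by rewrite perm_cons.
by rewrite -cat1s perm_catCA /= perm_cons.
Qed.

(* The words t such that gamma_t occurs in Xi^r gamma_p, with multiplicity: the
   letters of p are distributed over blocks with sums r, read one by one. *)
Fixpoint mergings (r p : seq nat) : seq (seq nat) :=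
  if r is s :: r' then
    flatten [seq [seq x.1 ++ t | t <- mergings r' x.2] | x <- splits p & sumn x.1 == s]
  else if p is [::] then [:: [::]] else [::].

Definition msh us f := \sum_(z <- mshuffle us) f z.

(** [sh_wprod] splits off one block at a time. By homogeneity only those splits survive whose first
    part has the length of the block as its sum, which is the filter in [mergings]. *)
Lemma msh_wprod F us p : graded F -> primitive F -> all (leq 1) p ->
  uniq (flatten us) ->
  msh us (wprod F p) = \sum_(t <- mergings (map size us) p) wprod F t (flatten us).
Proof.
move=> gF pF; elim: us p => [|u us IH] p p0 uq /=.
  rewrite /msh big_seq1; case: p p0 => [|m p] /=; first by rewrite big_seq1.
  case/andP=> m0 _; rewrite big_nil (cut_prod_homog _ _ (gF m)) /=.
  by case: m m0.
have uqs : uniq (flatten us) by move: uq; rewrite /= cat_uniq => /and3P[].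
rewrite /msh /= big_flatten big_map.
transitivity (\sum_(z <- mshuffle us) \sum_(x <- splits p)
   wprod F x.1 u * wprod F x.2 z).
  apply: eq_big_seq => z; rewrite mem_mshuffle // => /andP[pz _].
  apply: sh_wprod => //; have -> // : uniq (u ++ z) = uniq (u ++ flatten us).
  by apply: perm_uniq; rewrite perm_cat2l.
rewrite exchange_big big_flatten big_map big_filter [RHS]big_mkcond /=.
apply: eq_big_seq => x xp; rewrite -mulr_sumr -/(msh us _) IH //; last first.
  have : all (leq 1) (x.1 ++ x.2) by rewrite (perm_all _ (mem_splits xp)).
  by rewrite all_cat => /andP[].
case: eqP => [sx|/eqP nsx]; last by rewrite (wprod_homog gF) ?mul0r // eq_sym.
rewrite mulr_sumr big_map; apply: eq_bigr => t _.
by rewrite wprod_catM.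
Qed.

End WordProducts.

Lemma perm_mergings r p t : t \in mergings r p -> perm_eq t p.
Proof.
elim: r p t => [|s r IH] p t /=; first by case: p => //; rewrite inE => /eqP->.
case/flatten_mapP=> x; rewrite mem_filter => /andP[_ /mem_splits px] /mapP[y yr ->].
by rewrite -(permPr px) perm_cat2l (IH _ _ yr).
Qed.

(** Each block has a positive sum and so receives at least one letter; if the lengths agree, it
    receives exactly one, equal to its sum. *)
Lemma size_mergings r p t : all (leq 1) r -> t \in mergings r p ->
  (size r <= size t)%N /\ ((size t <= size r)%N -> t = r).
Proof.
elim: r p t => [|s r IH] p t /=.
  by move=> _; case: p => //; rewrite inE => /eqP->.
case/andP=> s0 r0 /flatten_mapP[x]; rewrite mem_filter => /andP[/eqP sx _].
case/mapP=> y /(IH _ _ r0)[le1 le2] ->; rewrite size_cat.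
move: s0; rewrite -sx; case: (x.1) => [|a l] //= _; split.
  by rewrite ltnS (leq_trans le1) // leq_addl.
rewrite ltnS => le; have /le2-> : (size y <= size r)%N.
  by apply: leq_trans le; apply: leq_addl.
case: l le => [|b l] le; first by rewrite /= addn0.
by have := leq_trans le le1; rewrite leqNgt /= ltnS leq_addl.
Qed.

Lemma mergings_self p : p \in mergings p p.
Proof.
elim: p => [|m p IH] //=.
have sp : ([::], p) \in splits p.
  elim: p {IH} => [|b q IH] //=; rewrite mem_cat; apply/orP; right.
  by apply/mapP; exists ([::], q).
apply/flatten_mapP; exists ([:: m], p); last by apply/mapP; exists p.
rewrite mem_filter /= addn0 eqxx mem_cat; apply/orP; left.
by apply/mapP; exists ([::], p).
Qed.

Lemma splits_perm (g : seq nat -> seq nat -> nat) p q :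
  (forall a a' b b', perm_eq a a' -> perm_eq b b' -> g a b = g a' b') ->
  perm_eq p q -> (\sum_(x <- splits p) g x.1 x.2 = \sum_(x <- splits q) g x.1 x.2)%N.
Proof.
move=> gP pq; elim/perm_eq_ind: pq g gP => [//|p1 q1 r1 IH1 IH2|a p1 q1 IH|a b p1] g gP.
- by rewrite IH1 // IH2.
- rewrite /= !big_cat !big_map /=; congr (_ + _)%N.
    by apply: (IH (fun x y => g (a :: x) y)) => *; apply: gP; rewrite ?perm_cons.
  by apply: (IH (fun x y => g x (a :: y))) => *; apply: gP; rewrite ?perm_cons.
have sw c d (l : seq nat) : perm_eq (c :: d :: l) (d :: c :: l).
  by rewrite -[c :: _]cat1s -[d :: l]cat1s perm_catCA.
rewrite /= !map_cat -!map_comp !big_cat !big_map /= -!addnA.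
congr (_ + _)%N; first by apply: eq_bigr => x _; apply: gP.
rewrite addnCA; congr (_ + (_ + _))%N.
by apply: eq_bigr => x _; apply: gP.
Qed.

(** Because of this, the scalar in gamma_q gamma_p is the same for all rearrangements p of q. *)
Lemma size_mergings_perm r p q : perm_eq p q ->
  size (mergings r p) = size (mergings r q).
Proof.
elim: r p q => [|s r IH] p q pq /=.
  case: p q pq => [|a p] [|b q] // /perm_size //.
rewrite !size_flatten /shape -!map_comp !sumnE !big_map !big_filter.
rewrite big_mkcond [RHS]big_mkcond /=.
under eq_bigr do rewrite size_map.
under [RHS]eq_bigr do rewrite size_map.
apply: (splits_perm (g := fun a b =>
          if sumn a == s then size (mergings r b) else 0%N)) => // a a' b b' pa pb.
by rewrite (perm_sumn pa) (IH _ _ pb).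
Qed.

(** * Permutations as words *)

Definition psums (q : seq nat) := [seq sumn (take k q) | k <- iota 1 (size q).-1].

Lemma psums_cons a b q : psums (a :: b :: q) = a :: map (addn a) (psums (b :: q)).
Proof.
rewrite /psums /= ?take0 /= addn0; congr (_ :: _).
by rewrite (iotaDl 1 1) -!map_comp; apply: eq_map => k /=.
Qed.

Lemma sorted_reshapeP q w : all (leq 1) q -> size w = sumn q ->
  reflect (forall i, (i.+1 < size w)%N -> i.+1 \notin psums q ->
             (nth 0%N w i < nth 0%N w i.+1)%N)
          (all (sorted ltn) (reshape q w)).
Proof.
elim: q w => [|a q IH] w /=.
  by move=> _ /size0nil->; apply: ReflectT.
case/andP=> a0 q0 sw.
have sd : size (drop a w) = sumn q by rewrite size_drop sw addKn.
have st : size (take a w) = a by rewrite size_takel // sw leq_addr.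
case: q => [|b q] in IH q0 sw sd *.
  rewrite /= addn0 in sw; rewrite -sw take_size andbT.
  by apply: (iffP (sortedP 0%N)) => h i lti; [move=> _|]; apply: h.
apply: (iffP andP) => [[/(sortedP 0%N) h1 /(IH _ q0 sd) h2] i lti|h].
  rewrite psums_cons inE negb_or => /andP[nia nips].
  case: (ltngtP i.+1 a) nia => // [ia|ai] _.
    by have := h1 i; rewrite st !nth_take ?(ltnW ia) //; apply.
  have lai : (a <= i)%N by [].
  have := h2 (i - a)%N; rewrite size_drop !nth_drop addnS subnKC // -subSn //.
  apply; first by rewrite ltn_sub2r // (ltn_trans ai).
  by apply: contraNN nips => h; apply/mapP; exists (i.+1 - a)%N;
    rewrite // subnKC // ltnW.
split.
  apply/(sortedP 0%N) => i; rewrite st => lti.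
  rewrite !nth_take ?(ltnW lti) //; apply: h.
    by rewrite sw (leq_trans lti) // leq_addr.
  rewrite psums_cons inE negb_or neq_ltn lti /=; apply/mapP=> -[j _ e].
  by move: lti; rewrite e ltnNge leq_addr.
apply/(IH _ q0 sd) => i; rewrite size_drop ltn_subRL !nth_drop addnS => lti nips.
apply: h => //; rewrite psums_cons inE negb_or; apply/andP; split.
  by rewrite neq_ltn ltnS leq_addr orbT.
by apply/mapP=> -[j jin]; rewrite -addnS => /addnI e; rewrite e jin in nips.
Qed.

(** Induction on [n] after shifting the set by one: if 1 belongs to it, a letter 1 is put in front,
    otherwise the first letter grows by 1. *)
Lemma composition_of_pred n (E : pred nat) : exists2 q, is_composition n q &
  forall i, (0 < i < n)%N -> (i \in psums q) = E i.
Proof.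
elim: n E => [|n IH] E; first by exists [::] => // i; rewrite ltn0 andbF.
case: n IH => [|n] IH; first by exists [:: 1%N] => // -[|[]].
have [q /andP[q0 /eqP sq] qE] := IH (fun i => E i.+1).
case: q q0 sq qE => [|b q] //= /andP[b0 q0] sq qE.
case E1: (E 1%N).
  exists [:: 1%N, b & q]; first by rewrite /is_composition /= b0 q0 sq /= add1n.
  move=> [|[|i]] // lti; rewrite psums_cons inE //= ?eqxx ?E1 //.
  rewrite -qE // -[i.+2]/(1 + i.+1)%N mem_map //; exact: addnI.
exists (b.+1 :: q); first by apply/andP; split=> //; apply/eqP; congr _.+1.
move=> i; case: q {q0} sq qE => [|c q] sq qE.
  case: i => [|[|i]] //.
  by move=> h; rewrite -qE.
case: i => [|[|i]] // lti.
  rewrite E1 psums_cons inE eqSS [_ == b]eq_sym -leqn0 leqNgt b0 /=.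
  apply/mapP=> -[j _] /eqP; rewrite addSn eqSS eq_sym addn_eq0.
  by rewrite -leqn0 leqNgt b0.
rewrite -qE // !psums_cons !inE eqSS; congr (_ || _).
apply/mapP/mapP=> -[j jin e]; exists j => //; first by case: e.
by rewrite addSn e.
Qed.

Section Words.
Variable n : nat.
Implicit Types s v t : 'S_n.

Definition word s : seq nat := [seq val (s i) | i <- enum 'I_n].

Lemma size_word s : size (word s) = n.
Proof. by rewrite size_map size_enum_ord. Qed.

Lemma nth_word s (i : 'I_n) : nth 0%N (word s) i = s i.
Proof. by rewrite (nth_map i) ?size_enum_ord // nth_ord_enum. Qed.

Lemma word_inj : injective word.
Proof.
move=> s t e; apply/permP=> i; apply/val_inj.
by rewrite -[LHS](nth_word s i) e nth_word.
Qed.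

Lemma word_uniq s : uniq (word s).
Proof.
by rewrite map_inj_uniq ?enum_uniq // => i j /val_inj /perm_inj.
Qed.

Lemma perm_word s : perm_eq (word s) (iota 0 n).
Proof.
apply: uniq_perm; rewrite ?word_uniq ?iota_uniq // => i.
rewrite mem_iota /= add0n; apply/mapP/idP => [[j _ ->]|lti]; first exact: ltn_ord.
by exists ((s^-1)%g (Ordinal lti)); rewrite ?mem_enum // permKV.
Qed.

Lemma mem_word s i : (i \in word s) = (i < n)%N.
Proof. by rewrite (perm_mem (perm_word s)) mem_iota. Qed.

Lemma wordP w : perm_eq w (iota 0 n) -> exists s, word s = w.
Proof.
move=> pw; have uw : uniq w by rewrite (perm_uniq pw) iota_uniq.
have sw : size w = n by rewrite (perm_size pw) size_iota.
have ltw (i : 'I_n) : (nth 0%N w i < n)%N.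
  have : nth 0%N w i \in iota 0 n by rewrite -(perm_mem pw) mem_nth ?sw.
  by rewrite mem_iota.
have finj : injective (fun i => Ordinal (ltw i)).
  by move=> i j /(congr1 val) /= /eqP; rewrite nth_uniq ?sw // => /eqP/val_inj.
exists (perm finj); apply: (@eq_from_nth _ 0%N); first by rewrite size_word sw.
move=> i; rewrite size_word => lti.
by rewrite (nth_word _ (Ordinal lti)) permE.
Qed.

Lemma sum_word (R : nmodType) (G : seq nat -> R) :
  \sum_(s : 'S_n) G (word s) = \sum_(z <- permutations (iota 0 n)) G z.
Proof.
rewrite -(big_map word predT G) /=; apply: perm_big; apply: uniq_perm.
- by rewrite map_inj_uniq ?index_enum_uniq //; apply: word_inj.
- exact: permutations_uniq.
move=> z; rewrite mem_permutations; apply/mapP/idP => [[s _ ->]|/wordP[s <-]].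
  exact: perm_word.
by exists s; rewrite // mem_index_enum.
Qed.

(** Products are read from left to right, so right multiplication by [v^-1] replaces each letter by
    its position in the word of [v]. *)
Lemma word_mulV s v : word (s * v^-1) = map (index^~ (word v)) (word s).
Proof.
transitivity [seq index (val (s i)) (word v) | i <- enum 'I_n].
  apply: eq_map => i /=; rewrite permM.
  move: (s i) => k; rewrite -{2}(permKV v k) -[val (v _)]nth_word.
  by rewrite index_uniq ?word_uniq ?size_word.
exact: (map_comp (index^~ (word v)) (fun i => val (s i))).

Qed.

Lemma Des_word s (i : 'I_n) : (i \in Des s) =
  (0 < i)%N && (nth 0%N (word s) i < nth 0%N (word s) i.-1)%N.
Proof.
rewrite inE; case: (posnP i) => //= i0.
rewrite !(nth_word s i); have <- : val (ord_pred i) = i.-1.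
  rewrite /= -{1}(prednK i0) addSn /= addnC modnDl modn_small //.
  by rewrite (leq_ltn_trans (leq_pred _)).
by rewrite nth_word.
Qed.

Lemma nth_word_lt s i j : (i < n)%N -> (j < n)%N -> i != j ->
  (nth 0%N (word s) i < nth 0%N (word s) j)%N = ~~
    (nth 0%N (word s) j < nth 0%N (word s) i)%N.
Proof.
move=> lti ltj nij; rewrite -leqNgt ltn_neqAle nth_uniq ?size_word ?word_uniq //.
by rewrite nij.
Qed.

Lemma Des_sub_word_set s q : is_composition n q ->
  (Des s \subset word_set n q) = all (sorted ltn) (reshape q (word s)).
Proof.
case/andP=> q0 /eqP sq; apply/subsetP/(sorted_reshapeP q0);
  rewrite ?size_word // => h i.
  move=> lti nip; have ni : i != i.+1 by rewrite neq_ltn ltnSn.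
  rewrite nth_word_lt ?(ltnW lti) //.
  apply: contraNN nip => di; have := h (Ordinal lti).
  by rewrite Des_word /= di => /(_ isT); rewrite inE.
rewrite Des_word inE; apply: contraLR => nip.
rewrite negb_and; case: i nip => -[|i] //= lti nip.
have ni : i != i.+1 by rewrite neq_ltn ltnSn.
by rewrite -nth_word_lt ?(ltnW lti) //; apply: h.
Qed.

End Words.

(** * Left multiplication by Xi as shuffling *)

Section GroupAlgebraWords.
Variables (K : fieldType) (n : nat).
Local Notation KS := (galg K 'S_n).
Implicit Types (x y : KS) (s v t : 'S_n).

Lemma galg_mulE x y s : (x * y) s = \sum_t (x t : K) * y (t^-1 * s)%g.
Proof. exact: ffunE. Qed.

Lemma galg_sumE (I : Type) (r : seq I) (P : pred I) (F : I -> KS) s :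
  (\sum_(i <- r | P i) F i) s = \sum_(i <- r | P i) (F i s : K).
Proof. by elim/big_rec2: _ => [|i y z _ <-]; rewrite ffunE. Qed.

Lemma galg_fiberE (T : finType) (f : 'S_n -> T) D s :
  (\sum_(t | f t == D) galg_elt K t) s = (f s == D)%:R.
Proof.
rewrite galg_sumE (eq_bigr (fun t => (s == t)%:R)) => [|t _]; last by rewrite ffunE.
case: (boolP (f s == D)) => fs.
  by rewrite (bigD1 s) //= eqxx big1 ?addr0 // => t /andP[_];
    rewrite eq_sym => /negbTE->.
by rewrite big1 // => t ft; case: eqP => // e; rewrite e ft in fs.
Qed.

Lemma Delta_setE D s : Delta_set K D s = (Des s == D)%:R.
Proof. exact: galg_fiberE. Qed.

Lemma Xi_setE D s : Xi_set K D s = (Des s \subset D)%:R.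
Proof.
rewrite galg_sumE; under eq_bigr do rewrite Delta_setE.
case: (boolP (Des s \subset D)) => sD.
  by rewrite (bigD1 (Des s)) //= eqxx big1 ?addr0 // => E /andP[_];
    rewrite eq_sym => /negbTE->.
by rewrite big1 // => E ED; case: eqP => // e; rewrite e ED in sD.
Qed.

Lemma XiE q s : is_composition n q ->
  Xi K n q s = wprod (incr K) q (word s).
Proof.
move=> qn; rewrite Xi_setE Des_sub_word_set // wprod_incr size_word.
by case/andP: qn => _ /eqP->; rewrite eqxx.
Qed.

Lemma sorted_index_subseq (u w : seq nat) : uniq w -> {subset u <= w} ->
  sorted ltn (map (index^~ w) u) = subseq u w.
Proof.
move=> uw suw; apply/idP/idP => [su|/(map_subseq (index^~ w))/subseq_sorted].
  set I := map _ u in su.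
  have -> : u = map (nth 0%N w) I.
    rewrite /I -map_comp map_id_in // => i /suw iw /=.
    by rewrite nth_index.
  rewrite -[X in subseq _ X](mkseq_nth 0%N); apply: map_subseq.
  have -> : I = [seq i <- iota 0 (size w) | i \in I].
    apply: (irr_sorted_eq ltn_trans ltnn su).
      by apply: sorted_filter (iota_ltn_sorted _ _); apply: ltn_trans.
    move=> i; rewrite mem_filter mem_iota; case: (boolP (i \in I)) => //=.
    by case/mapP=> j /suw jw ->; rewrite index_mem jw.
  exact: filter_subseq.
apply; first exact: ltn_trans.
have -> : map (index^~ w) w = iota 0 (size w); last exact: iota_ltn_sorted.
apply: (@eq_from_nth _ 0%N); rewrite size_map ?size_iota // => i lti.
by rewrite (nth_map 0%N) // index_uniq // nth_iota.
Qed.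

(** Put t = s v^-1 in the convolution sum. The blocks of the word of t increase exactly when the
    blocks of the word of [s] are subsequences of the word of v, that is, when the latter is a
    shuffle of these blocks. *)
Lemma Xi_mulE r x (F : seq nat -> K) s : is_composition n r ->
  (forall v, F (word v) = x v) -> (Xi K n r * x) s = msh (reshape r (word s)) F.
Proof.
move=> rn Fx; have /andP[_ /eqP sr] := rn.
have fl : flatten (reshape r (word s)) = word s by rewrite reshapeKr // sr size_word.
rewrite galg_mulE (reindex_inj (inj_comp (mulgI s) invg_inj)) /=.
transitivity (\sum_(v : 'S_n) (all (subseq^~ (word v)) (reshape r (word s)))%:R * F
  (word v)).
  apply: eq_bigr => v _; rewrite Fx invMg invgK mulgKV XiE // wprod_incr size_word sr
    eqxx.
  rewrite word_mulV; congr ((nat_of_bool _)%:R * _); rewrite -map_reshape all_map /=.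
  apply: eq_in_all => u ur /=; apply: sorted_index_subseq; first exact: word_uniq.
  move=> i iu; rewrite mem_word -(mem_word s) -fl.
  by apply/flattenP; exists u.
rewrite (@sum_word n _ (fun z => (all (subseq^~ z) (reshape r (word s)))%:R * F z)).
rewrite (eq_bigr (fun z => if all (subseq^~ z) (reshape r (word s)) then F z else
  0)); last first.
  by move=> z _; case: ifP; rewrite ?mul1r ?mul0r.
rewrite -big_mkcond -big_filter; apply: perm_big; apply: uniq_perm.
- exact/filter_uniq/permutations_uniq.
- by apply: mshuffle_uniq; rewrite fl word_uniq.
move=> z; rewrite mem_filter mem_permutations mem_mshuffle fl ?word_uniq //.
by rewrite andbC (permPr (perm_word s)).
Qed.
End GroupAlgebraWords.

(** * Bases of the descent algebra *)

(* A word whose descents are exactly at the partial sums of q. *)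
Fixpoint ribbon (q : seq nat) : seq nat :=
  if q is a :: q' then iota (sumn q') a ++ ribbon q' else [::].

Lemma size_ribbon q : size (ribbon q) = sumn q.
Proof. by elim: q => //= a q IH; rewrite size_cat size_iota IH. Qed.

Lemma perm_ribbon q : perm_eq (ribbon q) (iota 0 (sumn q)).
Proof.
elim: q => //= a q IH; rewrite addnC iotaD add0n perm_catC.
by rewrite perm_cat2r.
Qed.

Lemma ribbon_incr q : all (sorted ltn) (reshape q (ribbon q)).
Proof.
elim: q => //= a q IH; rewrite take_size_cat ?size_iota // drop_size_cat ?size_iota //.
by rewrite IH iota_ltn_sorted.
Qed.

(** Increasing blocks cannot cross a descent, so [r] refines [a :: q]. The start [c] of the first
    run is free because a run that is partly used up must again have this form. *)
Lemma ribbon_finer r a c q : all (leq 1) r -> all (leq 1) (a :: q) ->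
  (sumn q <= c)%N -> sumn r = (a + sumn q)%N ->
  all (sorted ltn) (reshape r (iota c a ++ ribbon q)) ->
  (size q < size r)%N /\ (size r = (size q).+1 -> r = a :: q).
Proof.
elim: r a c q => [|b r IH] a c q /=.
  by move=> _ /andP[a0 _] _ /esym/eqP; rewrite addn_eq0 => /andP[/eqP a00];
    rewrite a00 in a0.
move=> /andP[b0 r0] /andP[a0 q0] lec sr.
case: (ltngtP b a) => [ba|ab|ba].
- have -> : iota c a = iota c b ++ iota (c + b)%N (a - b)%N.
    by rewrite -iotaD subnKC // ltnW.
  rewrite -catA drop_size_cat ?size_iota // => /andP[_ /IH[]] //=.
  + by rewrite subn_gt0 ba q0.
  + by rewrite (leq_trans lec) // leq_addr.
  + by apply/eqP; rewrite -(eqn_add2l b) sr addnA subnKC // ltnW.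
  move=> h1 h2; split; first exact: ltnW.
  by move=> [e]; move: h1; rewrite e ltnn.
- case/andP=> /(sortedP 0%N) /(_ a.-1) srt _; exfalso.
  case: q q0 lec sr srt => [|d q] q0 lec sr srt.
    by move: ab; rewrite -(addn0 a) -sr ltnNge leq_addr.
  move/andP: q0 => /= [d0 _]; move: srt; rewrite prednK // size_takel; last first.
    by rewrite size_cat size_iota /= size_cat size_iota size_ribbon -sr leq_addr.
  rewrite !nth_take // ?(leq_ltn_trans (leq_pred a)) //.
  rewrite !nth_cat !size_iota prednK // ltnn leqnn subnn d0 !nth_iota ?prednK //.
  move=> /(_ ab) /=; rewrite addn0 ltnNge (leq_trans _ (leq_addr _ _)) //.
  by rewrite (leq_trans _ lec) //= leq_addl.
rewrite ba in sr *; rewrite drop_size_cat ?size_iota // => /andP[_ h].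
move/addnI: sr; case: q q0 lec h => [|d q] q0 lec h sr.
  by move: r0; case: (r) sr => [|e r'] //= /eqP; rewrite addn_eq0 => /andP[/eqP->].
have [h1 h2] := IH d (sumn q) q r0 q0 (leqnn _) sr h.
by split=> // -[/h2 ->].
Qed.

Section Bases.
Variable K : fieldType.

(** Here [M w v] plays the role of a functional attached to [w], evaluated at [b v]; triangularity
    with respect to [rank] kills the coefficients by strong induction. It yields the independence of
    the Xi, of the gamma words, and of their evaluations in K[X]. *)
Lemma triangular_coef0 (V : lmodType K) (ws : seq (seq nat)) (b : seq nat -> V)
    (M : seq nat -> seq nat -> K) (rank : seq nat -> nat) (c : seq nat -> K) :
  uniq ws ->
  (forall w, w \in ws -> \sum_(v <- ws) c v *: b v = 0 -> \sum_(v <- ws) c v * M w v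
    = 0) ->
  (forall w, w \in ws -> M w w != 0) ->
  (forall w v, w \in ws -> v \in ws -> w != v -> M w v != 0 -> (rank v < rank w)%N) ->
  \sum_(v <- ws) c v *: b v = 0 -> forall w, w \in ws -> c w = 0.
Proof.
move=> uws M0 Mw Mr cb w; have [m] := ubnP (rank w); elim: m w => // m IH w ltm ww.
have := M0 w ww cb; rewrite (bigD1_seq w) //= big1_seq ?addr0 => [|v /andP[nvw vw]].
  by move/eqP; rewrite mulf_eq0 (negPf (Mw w ww)) orbF => /eqP.
have [->|Mwv] := eqVneq (M w v) 0; first by rewrite mulr0.
rewrite IH ?mul0r // -ltnS (leq_trans _ ltm) // ltnS Mr // eq_sym //.
Qed.

Lemma free_map (V : vectType K) (ws : seq (seq nat)) (b : seq nat -> V) : uniq ws ->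
  (forall c : seq nat -> K, \sum_(v <- ws) c v *: b v = 0 ->
     forall w, w \in ws -> c w = 0) -> free (map b ws).
Proof.
move=> uws h; change (is_true (free (map_tuple b (in_tuple ws)))).
apply/freeP => k sk i.
pose c w := \sum_(i < size ws | tnth (in_tuple ws) i == w) k i.
have ci (j : 'I_(size ws)) : c (tnth (in_tuple ws) j) = k j.
  rewrite /c (bigD1 j) //= big1 ?addr0 // => l /andP[/eqP e] /negP[].
  by rewrite -val_eqE /= -(nth_uniq [::] _ _ uws) // -!(tnth_nth [::] (in_tuple ws)) e.
rewrite -ci; apply: h; last exact: mem_tnth.
rewrite -[RHS]sk big_tnth; apply: eq_bigr => j _.
by rewrite ci -tnth_nth tnth_map.
Qed.

Variable n : nat.
Local Notation KS := (galg K 'S_n).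

Lemma Xi_free : free (map (Xi K n) (compositions n)).
Proof.
have rw q : is_composition n q -> exists s : 'S_n, word s == ribbon q.
  move=> /andP[_ /eqP sq]; have : perm_eq (ribbon q) (iota 0 n).
    by rewrite -sq perm_ribbon.
  by case/wordP=> s e; exists s; rewrite e.
pose s q := odflt 1%g [pick s : 'S_n | word s == ribbon q].
have sP q : is_composition n q -> word (s q) = ribbon q.
  move=> /rw[t tq]; rewrite /s; case: pickP => [v /eqP//|/(_ t)].
  by rewrite tq.
apply: free_map => [|c]; first exact: compositions_uniq.
(* At the ribbon permutation of [w], Xi^v is nonzero only if v refines [w]; then v is longer, so the
   rank has to decrease with the length. *)
apply: (@triangular_coef0 _ _ _ (fun w v => Xi K n v (s w)) (fun w => n - size w)%N).
- exact: compositions_uniq.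
- move=> w _ /ffunP/(_ (s w)); rewrite galg_sumE ffunE => e; rewrite -[RHS]e.
  by apply: eq_bigr => v _; rewrite ffunE.
- move=> w; rewrite mem_compositions => wn; rewrite XiE // sP // wprod_incr.
  by rewrite size_ribbon eqxx ribbon_incr oner_neq0.
move=> w v; rewrite !mem_compositions => wn vn nwv; rewrite XiE // sP // wprod_incr.
case/andP: (wn) => w0 /eqP sw; case/andP: (vn) => v0 /eqP sv.
rewrite size_ribbon sw sv eqxx /=; case: (boolP (all _ _)) => [|_];
  last by rewrite eqxx.
case: w w0 sw nwv {wn} => [|a q] w0 sw nwv.
  by move: v0; case: (v) sv nwv => [|b v'] //=; rewrite -sw => /eqP;
    rewrite addn_eq0 => /andP[/eqP->].
move=> h _; have [h1 h2] : (size q < size v)%N /\ (size v = (size q).+1 -> v = a :: q).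
  by apply: (@ribbon_finer v a (sumn q)); rewrite // sv -sw.
have lt : (size (a :: q) < size v)%N.
  rewrite ltn_neqAle h1 andbT; apply: contraNneq nwv => e.
  by apply/eqP/esym/h2; rewrite -e.
have lev : (size v <= n)%N.
  rewrite -sv; elim: (v) v0 => //= d l IH /andP[d0 /IH]; rewrite -add1n.
  exact: leq_add.
by rewrite ltn_sub2l // (leq_trans lt).
Qed.

Lemma descent_alg_span : descent_alg K n = <<map (Xi K n) (compositions n)>>%VS.
Proof.
(* The set [D] may contain 0, but no descent set does, so [q] has to agree with [D] only at positive
   places. *)
have XiD D : exists2 q, q \in compositions n & Xi_set K D = Xi K n q.
  have [q qn qD] := composition_of_pred n (fun i => i \in map val (enum D)).
  exists q; rewrite ?mem_compositions //; apply/ffunP=> s; rewrite !Xi_setE;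
    congr (nat_of_bool _)%:R.
  apply/subsetP/subsetP => h i iD; have i0 : (0 < i)%N by move: iD;
    rewrite inE => /andP[].
    by rewrite inE qD ?i0 //= mem_map ?mem_enum ?h //; apply: val_inj.
  by have := h i iD; rewrite inE qD ?i0 //= mem_map ?mem_enum //; apply: val_inj.
apply/eqP; rewrite eqEsubv; apply/andP; split; apply/span_subvP => x.
  (* Inversion of the triangular system that defines the Xi, by induction on the cardinality of
     [D]. *)
  case/imageP=> D _ ->; have [m] := ubnP #|D|; elim: m D => // m IH D ltm.
  have -> : Delta_set K D = Xi_set K D - \sum_(E : {set 'I_n} | E \proper D)
    Delta_set K E.
    rewrite /Xi_set (bigD1 D) //= [X in _ + X - _](eq_bigl
      (fun E : {set _} => E \proper D)).
      by rewrite addrK.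
    by move=> E; rewrite properEneq andbC.
  rewrite memvB //; first by have [q qn ->] := XiD D; rewrite memv_span // map_f.
  apply: memv_suml => E ED; apply: IH; rewrite -ltnS (leq_trans _ ltm) // ltnS.
  exact: proper_card.
case/mapP=> q _ ->; apply: memv_suml => E _; apply: memv_span.
by apply/imageP; exists E.
Qed.

Lemma Xi_in q : Xi K n q \in descent_alg K n.
Proof.
by apply: memv_suml => E _; apply: memv_span; apply/imageP; exists E.
Qed.

End Bases.

(** * Elements of the descent algebra as functions on words *)

Section Functionals.
Variables (K : fieldType) (V : lmodType K) (f : V -> K).
Hypothesis f_lin : linear (f : V -> K^o).

Lemma functionalD x y : f (x + y) = f x + f y.
Proof. by have := f_lin 1 x y; rewrite !scale1r. Qed.

Lemma functional0 : f 0 = 0.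
Proof. by apply: (addrI (f 0)); rewrite -functionalD !addr0. Qed.

Lemma functionalZ k x : f (k *: x) = k * f x.
Proof. by have := f_lin k x 0; rewrite functional0 !addr0. Qed.

Lemma functional_sum (I : Type) (r : seq I) (P : pred I) (F : I -> V) :
  f (\sum_(i <- r | P i) F i) = \sum_(i <- r | P i) f (F i).
Proof.
by elim/big_rec2: _ => [|i y x _ <-]; [apply: functional0 | apply: functionalD].
Qed.

End Functionals.

Section Coefficients.
Variables (K : fieldType) (V : vectType K) (ws : seq (seq nat)) (b : seq nat -> V).

(** Coordinates indexed by words. The functional is linear on all of [V], but carries meaning only
    on the span of a free family. *)
Definition bcoef w (x : V) : K := lin_ext ws b (fun q => (q == w)%:R : K^o) x.

Lemma lin_extE (U : vectType K) (f : seq nat -> U) x : uniq ws ->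
  lin_ext ws b f x = \sum_(w <- ws) bcoef w x *: f w.
Proof.
move=> uws; rewrite big_tnth /lin_ext; apply: eq_bigr => i _; congr (_ *: _).
rewrite /bcoef /lin_ext (bigD1 i) //= eqxx big1 ?addr0 => [|j nji].
  exact/esym/mulr1.
case: eqP => [e|_]; last exact: mulr0.
move: nji; rewrite -val_eqE /= -(nth_uniq [::] _ _ uws) //.
by rewrite -!(tnth_nth [::] (in_tuple ws)) e eqxx.
Qed.

Lemma bcoef_sum x : uniq ws -> x \in <<map b ws>>%VS ->
  x = \sum_(w <- ws) bcoef w x *: b w.
Proof.
move=> uws xin; rewrite -(lin_extE b x uws) /lin_ext.
rewrite {1}(coord_span (X := map_tuple b (in_tuple ws)) xin).
by apply: eq_bigr => i _; rewrite -tnth_nth tnth_map.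
Qed.

Lemma bcoefE w v : free (map b ws) -> v \in ws -> bcoef w (b v) = (v == w)%:R.
Proof. by move=> fr vw; rewrite /bcoef lin_ext_basis. Qed.

Lemma bcoef_lin w : linear (bcoef w : V -> K^o).
Proof. exact: lin_ext_is_linear. Qed.

End Coefficients.

Lemma is_composition_cat k l r q : is_composition k r -> is_composition l q ->
  is_composition (k + l) (r ++ q).
Proof.
by move=> /andP[r0 /eqP sr] /andP[q0 /eqP sq];
  rewrite /is_composition all_cat r0 q0 sumn_cat sr sq /=.
Qed.

Section WordFunctions.
Variable K : fieldType.
Local Notation KS n := (galg K 'S_n).

(* The value of x at any permutation with the same relative order as the word z. *)
Definition wf n (x : KS n) (z : seq nat) : K :=
  \sum_(q <- compositions n) bcoef (compositions n) (Xi K n) q x * wprod (incr K) q z.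

Lemma wf_lin n z : linear (fun x : KS n => wf x z : K^o).
Proof.
move=> k x y; rewrite /wf scaler_sumr -big_split; apply: eq_bigr => q _.
by rewrite bcoef_lin mulrDl -mulrA.
Qed.

Lemma wf_graded n (x : KS n) z : size z != n -> wf x z = 0.
Proof.
move=> sz; rewrite /wf big1_seq // => q /andP[_].
rewrite mem_compositions => /andP[_ /eqP sq].
by rewrite (wprod_homog (@incr_graded K)) ?mulr0 // sq.
Qed.

Lemma wf_Xi n q z : is_composition n q -> wf (Xi K n q) z = wprod (incr K) q z.
Proof.
rewrite -mem_compositions => qn; rewrite /wf (bigD1_seq q) ?compositions_uniq //=.
rewrite bcoefE ?Xi_free // eqxx mul1r big1_seq ?addr0 // => v /andP[nvq vn].
by rewrite bcoefE ?Xi_free // eq_sym (negPf nvq) mul0r.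
Qed.

Lemma wf_word n (x : KS n) s : x \in descent_alg K n -> wf x (word s) = x s.
Proof.
rewrite descent_alg_span => /(bcoef_sum (compositions_uniq n)) {2}->.
rewrite galg_sumE; apply: eq_big_seq => q; rewrite mem_compositions => qn.
by rewrite ffunE XiE.
Qed.

Lemma outer_prodE k l (x : KS k) (y : KS l) :
  outer_prod x y = \sum_(r <- compositions k) \sum_(q <- compositions l)
    (bcoef (compositions k) (Xi K k) r x * bcoef (compositions l) (Xi K l) q y)
      *: Xi K (k + l) (r ++ q).
Proof.
rewrite /outer_prod /concat_prod lin_extE ?compositions_uniq //.
apply: eq_bigr => r _; rewrite lin_extE ?compositions_uniq // scaler_sumr.
by apply: eq_bigr => q _; rewrite scalerA.
Qed.

Lemma outer_prod_in k l (x : KS k) (y : KS l) : outer_prod x y \in descent_alg K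
  (k + l).
Proof.
by rewrite outer_prodE; do 2 apply: memv_suml => ? _; rewrite memvZ // Xi_in.
Qed.

Lemma wf_outer_prod k l (x : KS k) (y : KS l) :
  wf (outer_prod x y) =1 cut_prod (wf x) (wf y).
Proof.
move=> z; rewrite outer_prodE.
transitivity (\sum_(r <- compositions k) \sum_(q <- compositions l)
  bcoef (compositions k) (Xi K k) r x * bcoef (compositions l) (Xi K l) q y *
    wprod (incr K) (r ++ q) z).
  rewrite (functional_sum (@wf_lin _ z)); apply: eq_big_seq => r.
  rewrite mem_compositions => rk.
  rewrite (functional_sum (@wf_lin _ z)); apply: eq_big_seq => q.
  rewrite mem_compositions => ql.
  by rewrite (functionalZ (@wf_lin _ z)) wf_Xi // is_composition_cat.
rewrite /cut_prod; under [RHS]eq_bigr do rewrite /wf big_distrlr /=.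
rewrite [RHS]exchange_big; apply: eq_bigr => r _.
rewrite [RHS]exchange_big; apply: eq_bigr => q _.
rewrite wprod_cat /cut_prod mulr_sumr; apply: eq_bigr => i _.
by rewrite mulrACA.
Qed.

Lemma component_id (V : nat -> vectType K) n (x : V n) : component n x = x.
Proof. by rewrite /component; case: eqP => // e; rewrite (eq_axiomK e). Qed.

Variable gamma : forall m, KS m.

Definition wgamma m : seq nat -> K := wf (gamma m).

Lemma wgamma_graded : graded wgamma.
Proof. by move=> m z; apply: wf_graded. Qed.

Lemma gamma_word_in n q : gamma_word gamma n q \in descent_alg K n.
Proof.
rewrite /gamma_word /component; case: eqP => [e|_]; last exact: mem0v.
case: n / e; case: q => [|m q]; first exact: Xi_in.
exact: outer_prod_in.
Qed.

Lemma wf_gamma_word n q z : sumn q = n ->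
  wf (gamma_word gamma n q) z = wprod wgamma q z.
Proof.
move=> sq; case: n / sq; rewrite /gamma_word component_id.
elim: q z => [|m q IH] z /=; first by rewrite wf_Xi.
by rewrite wf_outer_prod; apply: eq_cut_prod.
Qed.

Lemma gamma_wordE n q s : is_composition n q ->
  gamma_word gamma n q s = wprod wgamma q (word s).
Proof.
by case/andP=> _ /eqP sq; rewrite -wf_word ?gamma_word_in // wf_gamma_word.
Qed.

Lemma gamma_word1 m : gamma m \in descent_alg K m -> gamma_word gamma m [:: m] =
  gamma m.
Proof.
move=> gin; apply/ffunP=> s; rewrite -[LHS]wf_word ?gamma_word_in // -[RHS]wf_word //.
rewrite wf_gamma_word /= ?addn0 // (cut_prod_homog _ _ (@wgamma_graded m)) size_word
  leqnn.
by rewrite take_oversize ?drop_oversize ?size_word // mulr1.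
Qed.

End WordFunctions.

Lemma shuffle_map (f : nat -> nat) u v :
  shuffle (map f u) (map f v) = map (map f) (shuffle u v).
Proof.
move: u v; apply: shuffle_ind => [v|u|a u b v IHu IHv] //.
  by rewrite !shuffleC0.
rewrite [map f (a :: u)]map_cons [map f (b :: v)]map_cons !shuffle_cons map_cat.
by rewrite -!map_cons IHu IHv -!map_comp.
Qed.

(** The map [f] lists the letters of [w] in increasing order, and [s] records their ranks. *)
Lemma standardization n w : uniq w -> size w = n ->
  exists s : 'S_n, exists2 f, w = map f (word s) &
    {in gtn n &, {mono f : i j / (i < j)%N}}.
Proof.
move=> uw sw; pose t := sort leq w.
have st : size t = n by rewrite size_sort.
have srt : sorted ltn t by rewrite ltn_sorted_uniq_leq sort_uniq uw sort_sorted //;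
  apply: leq_total.
have tw i : (i \in t) = (i \in w) by rewrite mem_sort.
have [|s ws] := @wordP n (map (index^~ t) w).
  apply: uniq_perm; rewrite ?iota_uniq //.
    rewrite map_inj_in_uniq // => i j iw jw e.
    by rewrite -(@nth_index _ 0%N i t) ?tw // e nth_index ?tw.
  move=> i; rewrite mem_iota /= add0n; apply/mapP/idP => [[j jw ->]|lti].
    by rewrite -st index_mem tw.
  by exists (nth 0%N t i); rewrite ?index_uniq ?sort_uniq ?st // -tw mem_nth ?st.
exists s; exists (nth 0%N t).
  by rewrite ws -map_comp map_id_in // => i iw; rewrite /= nth_index ?tw.
have h i j : (i < n)%N -> (j < n)%N -> (i < j)%N -> (nth 0%N t i < nth 0%N t j)%N.
  by move=> lti ltj; apply: (sorted_ltn_nth ltn_trans 0%N srt); rewrite inE st.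
move=> i j; rewrite !inE => lti ltj; case: (ltngtP i j) => [||->]; last exact: ltnn.
  exact: h.
by move/(h j i ltj lti) => /ltnW; rewrite ltnNge => ->.
Qed.

(** * Lie series *)

Lemma psums_hook k m : psums (rcons (nseq k 1%N) m) = iota 1 k.
Proof.
rewrite /psums size_rcons size_nseq /=.
rewrite -[RHS]map_id; apply/eq_in_map => j; rewrite mem_iota add1n ltnS => /andP[_ lej].
rewrite -cats1 takel_cat ?size_nseq // take_nseq //.
by rewrite sumn_nseq mul1n.
Qed.

Section Omega.
Variables (K : fieldType) (n : nat).
Local Notation KS := (galg K 'S_n).

(** The hook word has partial sums 1, ..., k. The lowest letter, at position k counted from 0,
    belongs both to the falling and to the rising part. *)
Lemma Des_hook (s : 'S_n) k : (k < n)%N ->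
  (Des s == word_set n (rcons (nseq k 1%N) (n - k)%N)) =
  sorted gtn (take k.+1 (word s)) && sorted ltn (drop k (word s)).
Proof.
move=> ltk; have mem_hook (i : 'I_n) :
    (i \in word_set n (rcons (nseq k 1%N) (n - k)%N)) = (0 < i <= k)%N.
  by rewrite inE -/(psums _) psums_hook mem_iota add1n ltnS.
apply/eqP/andP=> [e|[/(sortedP 0%N) h1 /(sortedP 0%N) h2]].
  have D i (lti : (i.+1 < n)%N) :
      (nth 0%N (word s) i.+1 < nth 0%N (word s) i)%N = (i < k)%N.
    by have := Des_word s (Ordinal lti); rewrite e mem_hook /= => <-.
  split; apply/(sortedP 0%N) => i.
    rewrite size_takel ?size_word // ltnS => ltik; rewrite !nth_take ?ltnS //=;
      last exact: ltnW.
    by rewrite D // (leq_ltn_trans ltik).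
  rewrite size_drop size_word ltn_subRL addnS => lti; rewrite !nth_drop addnS /=.
  have ni : (k + i != (k + i).+1)%N by rewrite neq_ltn ltnSn.
  by rewrite nth_word_lt ?(ltnW lti) // D // -leqNgt leq_addr.
apply/setP=> i; rewrite mem_hook Des_word; case: i => -[|i] //= lti.
case: (ltnP i k) => ik.
  have := h1 i; rewrite size_takel ?size_word // ltnS !nth_take ?ltnS ?(ltnW ik) //=.
  exact.
have := h2 (i - k)%N; rewrite size_drop size_word -subSn // ltn_sub2r //
  ?(leq_ltn_trans ik) //.
rewrite !nth_drop !subnKC // ?(leqW ik) //.
by move=> /(_ isT) /= /ltnW; rewrite leqNgt => /negbTE.
Qed.

Lemma omega_word (s : 'S_n) : (0 < n)%N ->
  omega K n s = - cut_prod (@dsgn_decr K) (@increasing K) (word s).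
Proof.
move=> n0; rewrite cut_prod_dsgn_decr ?word_uniq -?size_eq0 ?size_word -?lt0n //.
rewrite galg_sumE; apply: eq_bigr => k _; rewrite ffunE Delta_setE Des_hook //.
Qed.

(** The identity has coefficient 1: its word has no descent, so only k = 0 contributes. *)
Lemma omega_neq0 : (0 < n)%N -> omega K n != 0.
Proof.
move=> n0; apply/eqP=> /ffunP/(_ 1%g); rewrite omega_word // ffunE.
have -> : word (1%g : 'S_n) = iota 0 n.
  apply: (@eq_from_nth _ 0%N); rewrite ?size_word ?size_iota // => i lti.
  by rewrite (nth_word _ (Ordinal lti)) perm1 nth_iota.
rewrite cut_prod_dsgn_decr ?iota_uniq -?size_eq0 ?size_iota -?lt0n //.
case: n n0 => // m _; rewrite big_ord_recl big1 => [|k _].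
  rewrite mul1r addr0 drop0 iota_ltn_sorted /= take0 /=; exact/eqP/oner_neq0.
case: m k => [[] //|m] k; rewrite (_ : sorted gtn _ = false) ?mulr0 //.
Qed.

Lemma msh2 (u v : seq nat) (f : seq nat -> K) : msh [:: u; v] f = sh u v f.
Proof. by rewrite /msh /= shuffleC0 /= !cats0. Qed.

Lemma reshape2 a b (w : seq nat) : (size w = a + b)%N ->
  reshape [:: a; b] w = [:: take a w; drop a w].
Proof. by move=> sw /=; rewrite (@take_oversize _ b) // size_drop sw addKn. Qed.

Lemma Xi_omega a b : (0 < a)%N -> (0 < b)%N -> (a + b)%N = n ->
  Xi K n [:: a; b] * omega K n = 0.
Proof.
move=> a0 b0 ab; have n0 : (0 < n)%N by rewrite -ab addn_gt0 a0.
apply/ffunP=> s; rewrite [RHS]ffunE.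
rewrite (@Xi_mulE _ _ _ _ (fun z => -1 * cut_prod (@dsgn_decr K) (@increasing K) z)).
- rewrite reshape2 ?size_word // msh2 shZ sh_omega ?mulr0 ?cat_take_drop ?word_uniq //.
    by rewrite -size_eq0 size_takel ?size_word -?lt0n // -ab leq_addr.
  by rewrite -size_eq0 size_drop size_word -ab addKn -lt0n.
- by rewrite /is_composition /= a0 b0 addn0 ab /=.
by move=> v; rewrite omega_word // mulN1r.
Qed.

(** The element [x] lies in the right ideal it generates, which is that of omega, and left
    multiplication by Xi^(a.b) annihilates this ideal. *)
Lemma Xi_mul_Lie a b x : (0 < a)%N -> (0 < b)%N -> (a + b)%N = n ->
  Lie_idempotent x -> Xi K n [:: a; b] * x = 0.
Proof.
move=> a0 b0 ab [_ xw].
have : (<[omega K n]> * fullv <= lker (amull (Xi K n [:: a; b])))%VS.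
  apply/prodvP=> u v /vlineP[k ->] _.
  by rewrite memv_ker lfunE /= mulrA -scalerAr Xi_omega // scaler0 mul0r.
move/subvP/(_ x); rewrite -xw memv_ker lfunE /= => h; apply/eqP/h.
by rewrite -[x in x \in _]mulr1; apply: memv_mul; rewrite ?memv_line ?memvf.
Qed.

End Omega.

Section LieSeries.
Variables (K : fieldType) (charK : [pchar K] =i pred0).
Variable gamma : forall m, galg K 'S_m.
Hypothesis gammaLie : Lie_series gamma.

Lemma natK_neq0 m : (0 < m)%N -> (m%:R : K) != 0.
Proof. by move=> m0; have /pcharf0P-> := charK; rewrite -lt0n. Qed.

Lemma gamma_in m : (0 < m)%N -> gamma m \in descent_alg K m.
Proof. by case/gammaLie. Qed.

Lemma Xi_mul_gamma_eq0 m a b : (0 < a)%N -> (0 < b)%N -> (a + b)%N = m ->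
  Xi K m [:: a; b] * gamma m = 0.
Proof.
move=> a0 b0 ab; have m0 : (0 < m)%N by rewrite -ab addn_gt0 a0.
have [_ L] := gammaLie m0; have := Xi_mul_Lie a0 b0 ab L.
rewrite -scalerAr => /eqP; rewrite scaler_eq0 invr_eq0 (negPf (natK_neq0 m0)).
by move/eqP.
Qed.

Lemma wf_mono n (x : galg K 'S_n) (f : nat -> nat) z :
  {in z &, {mono f : i j / (i < j)%N}} -> wf x (map f z) = wf x z.
Proof.
move=> fm; apply: eq_bigr => q _; rewrite !wprod_incr size_map;
  congr (_ * (nat_of_bool _)%:R).
case: eqP => //= sz; rewrite -map_reshape all_map; apply: eq_in_all => u uz /=.
apply: (mono_sorted_in fm); apply/allP=> i iu.
by rewrite -(@reshapeKr _ q z) ?sz //; apply/flattenP; exists u.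
Qed.

(* Elements of the descent algebra see only the relative order of letters, so
   the vanishing of Xi^(a.b) gamma_m says that gamma_m kills proper shuffles of
   any two words. *)
Lemma wgamma_primitive : primitive (wgamma gamma).
Proof.
move=> m u v uq u0 v0; have [sm|/eqP sm] := eqVneq (size (u ++ v)) m; last first.
  rewrite /sh big1_seq // => z /andP[_ /(size_shuffle uq) sz].
  by apply: wgamma_graded; rewrite sz -size_cat; apply/eqP.
have [s [f uvf fm]] := standardization uq sm.
have su : u = map f (take (size u) (word s)) by rewrite map_take -uvf take_size_cat.
have sv : v = map f (drop (size u) (word s)) by rewrite map_drop -uvf drop_size_cat.
have ab : (size u + size v)%N = m by rewrite -size_cat.
have a0 : (0 < size u)%N by rewrite lt0n size_eq0.
have b0 : (0 < size v)%N by rewrite lt0n size_eq0.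
have := Xi_mul_gamma_eq0 a0 b0 ab => /ffunP/(_ s).
have m0 : (0 < m)%N by rewrite -ab addn_gt0 a0.
rewrite (@Xi_mulE _ _ _ _ (wgamma gamma m)); last first.
- by move=> t; rewrite /wgamma wf_word // gamma_in.
- by rewrite /is_composition /= a0 b0 addn0 ab /=.
rewrite reshape2 ?size_word // msh2 [RHS]ffunE => <-.
rewrite {1}su {1}sv /sh shuffle_map big_map; apply: eq_big_seq => z.
rewrite mem_shuffle ?cat_take_drop ?word_uniq // => /and3P[pz _ _].
apply: wf_mono => i j iz jz; apply: fm; rewrite inE -(mem_word s).
  by rewrite -(perm_mem pz).
by rewrite -(perm_mem pz).
Qed.

Variable n : nat.
Local Notation g := (gamma_word gamma n).

(** [Xi_mulE] turns the product into a sum over shuffles of blocks, which primitivity of the gamma_m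
    evaluates by [msh_wprod]. *)
Lemma Xi_mul_gamma_word r p : is_composition n r -> is_composition n p ->
  Xi K n r * g p = \sum_(t <- mergings r p) g t.
Proof.
move=> rn pn; have /andP[r0 /eqP sr] := rn; have /andP[p0 /eqP sp] := pn.
apply/ffunP=> s; rewrite galg_sumE (@Xi_mulE _ _ _ _ (wprod (wgamma gamma) p)) //.
  have fl : flatten (reshape r (word s)) = word s by rewrite reshapeKr // sr size_word.
  rewrite (msh_wprod (@wgamma_graded _ gamma) wgamma_primitive p0) ?fl ?word_uniq //.
  rewrite -/(shape _) reshapeKl ?sr ?size_word //;
    apply: eq_big_seq => t /perm_mergings tp.
  by rewrite gamma_wordE // /is_composition (perm_all _ tp) p0 (perm_sumn tp) sp /=.
by move=> v; rewrite gamma_wordE.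
Qed.

Definition lead m : K := bcoef (compositions m) (Xi K m) [:: m] (gamma m).

(** Each gamma_m is expanded in the Xi and the outer product is multiplied out. Equal words are not
    collected, since only the coefficient of [q] itself will matter. *)
Fixpoint Xi_expansion (q : seq nat) : seq (K * seq nat) :=
  if q is m :: q' then
    [seq (bcoef (compositions m) (Xi K m) s (gamma m) * x.1, s ++ x.2)
      | s <- compositions m, x <- Xi_expansion q']
  else [:: (1, [::])].

Lemma wprod_expansion q z :
  wprod (wgamma gamma) q z = \sum_(x <- Xi_expansion q) x.1 * wprod (incr K) x.2 z.
Proof.
elim: q z => [|m q IH] z /=; first by rewrite big_seq1 /= mul1r.
rewrite big_allpairs_dep /=.
transitivity (\sum_(i < (size z).+1) \sum_(s <- compositions m)
  \sum_(x <- Xi_expansion q)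
  (bcoef (compositions m) (Xi K m) s (gamma m) * wprod (incr K) s (take i z)) *
  (x.1 * wprod (incr K) x.2 (drop i z))).
  by apply: eq_bigr => i _; rewrite IH /wgamma /wf big_distrlr.
rewrite exchange_big; apply: eq_bigr => s _.
rewrite exchange_big; apply: eq_bigr => x _.
rewrite wprod_cat /cut_prod mulr_sumr; apply: eq_bigr => i _.
by rewrite mulrACA.
Qed.

Lemma mem_Xi_expansion q x : all (leq 1) q -> x \in Xi_expansion q ->
  is_composition (sumn q) x.2 /\ (size q <= size x.2)%N.
Proof.
elim: q x => [|m q IH] x /=; first by rewrite inE => _ /eqP->.
case/andP=> m0 q0 /allpairsPdep[s [y [sm yq ->]]] /=.
have [y1 y2] := IH y q0 yq; move: sm; rewrite mem_compositions => sm.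
split; first exact: is_composition_cat.
case: s sm => [|a s] sm; last by rewrite size_cat /= ltnS (leq_trans y2) // leq_addl.
by move: sm => /andP[_ /eqP /= e]; rewrite -e in m0.
Qed.

(** A factor gamma_m contributes a single letter only through Xi^m. Any other choice makes the word
    longer than [q], and there [phi] vanishes. *)
Lemma Xi_expansion_lead (V : lmodType K) (phi : seq nat -> V) q : all (leq 1) q ->
  (forall s, (size q < size s)%N -> phi s = 0) ->
  \sum_(x <- Xi_expansion q) x.1 *: phi x.2 = (\prod_(m <- q) lead m) *: phi q.
Proof.
elim: q phi => [|m q IH] phi /=; first by rewrite big_seq1 big_nil.
case/andP=> m0 q0 phi0; rewrite big_allpairs_dep /= big_cons.
rewrite (bigD1_seq [:: m]) ?compositions_uniq ?mem_compositions //=; last first.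
  by rewrite /is_composition /= m0 addn0 eqxx.
rewrite [X in _ + X]big1_seq ?addr0 => [|s /andP[nsm]].
  under eq_bigr do rewrite -scalerA.
  rewrite -scaler_sumr -scalerA (IH (fun s => phi (m :: s))) // => s lts.
  exact: phi0.
rewrite mem_compositions => /andP[_ /eqP ss]; rewrite big1_seq // => x /andP[_ xq].
rewrite phi0 ?scaler0 // size_cat; have [_ lex] := mem_Xi_expansion q0 xq.
case: s nsm ss => [|a [|b s]] nsm ss; first by rewrite -ss in m0.
  by rewrite /= addn0 in ss; rewrite ss eqxx in nsm.
by rewrite /= !addSn ltnS ltnS (leq_trans lex) // leq_addl.
Qed.

Lemma gamma_word_expansion q : is_composition n q ->
  g q = \sum_(x <- Xi_expansion q) x.1 *: Xi K n x.2.
Proof.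
move=> qn; case/andP: (qn) => q0 /eqP sq; apply/ffunP=> s.
rewrite gamma_wordE // wprod_expansion galg_sumE; apply: eq_big_seq => x xq.
have [xn _] := mem_Xi_expansion q0 xq; rewrite sq in xn.
by rewrite ffunE XiE.
Qed.

Lemma mergings_nil r p : all (leq 1) r -> (size p < size r)%N -> mergings r p = [::].
Proof.
move=> r0 lt; case e: (mergings r p) => [//|t l].
have tin : t \in mergings r p by rewrite e inE eqxx.
have [le _] := size_mergings r0 tin.
by move: lt; rewrite -(perm_size (perm_mergings tin)) ltnNge le.
Qed.

(** Words longer than [q], hence than [p], annihilate gamma_p. In Xi^q gamma_p only words of length
    at most that of [q] can occur, and [size_mergings] identifies them with [q]. *)
Lemma gamma_mul q p : is_composition n q -> is_composition n p ->
  (size p <= size q)%N ->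
  g q * g p = ((\prod_(m <- q) lead m) * (size (mergings q p))%:R) *: g q.
Proof.
move=> qn pn leqp; case/andP: (qn) => q0 /eqP sq.
rewrite {1}gamma_word_expansion // mulr_suml.
transitivity (\sum_(x <- Xi_expansion q) x.1 *: \sum_(t <- mergings x.2 p) g t).
  apply: eq_big_seq => x xq; have [xn _] := mem_Xi_expansion q0 xq; rewrite sq in xn.
  by rewrite -scalerAl Xi_mul_gamma_word.
(* The cut-off by positivity makes the function vanish on every word longer than [q], as
   [Xi_expansion_lead] demands; [mergings_nil] covers only words of positive letters. *)
rewrite big_seq_cond (eq_bigr (fun x => x.1 *: if all (leq 1) x.2 then
  \sum_(t <- mergings x.2 p) g t else 0)); last first.
  by move=> x /andP[/(mem_Xi_expansion q0)[/andP[-> _] _] _].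
rewrite -big_seq_cond (Xi_expansion_lead (phi := fun s => if all (leq 1) s then
  \sum_(t <- mergings s p) g t else 0)) //; last first.
  move=> s lts; case: ifP => // s0; rewrite mergings_nil ?big_nil //.
  exact: leq_ltn_trans lts.
rewrite q0 -scalerA; congr (_ *: _).
rewrite (eq_big_seq (fun => g q)) => [|t tin].
  by rewrite big_const_seq count_predT iter_addr_0 scaler_nat.
have [_ ->] := size_mergings q0 tin; rewrite //.
by rewrite (perm_size (perm_mergings tin)).
Qed.

Lemma gamma_mul_eq0 q p : is_composition n q -> is_composition n p ->
  (size p <= size q)%N -> ~~ perm_eq q p -> g q * g p = 0.
Proof.
move=> qn pn leqp nqp; rewrite gamma_mul //; case/andP: (qn) => q0 _.
case e: (mergings q p) => [|t l]; first by rewrite mulr0 scale0r.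
have tin : t \in mergings q p by rewrite e inE eqxx.
have tp := perm_mergings tin; have [_ tq] := size_mergings q0 tin.
by rewrite -tq ?tp ?(perm_size tp) in nqp.
Qed.

(** The scalar that makes gamma_q an idempotent up to normalization: gamma_q gamma_q is this
    multiple of gamma_q. *)
Definition gamma_norm q : K :=
  (\prod_(m <- q) lead m) * (size (mergings q q))%:R.

Lemma gamma_mul_perm q p : is_composition n q -> perm_eq q p ->
  g q * g p = gamma_norm q *: g q.
Proof.
move=> qn qp; rewrite gamma_mul // ?(perm_size qp) //.
  by rewrite /gamma_norm (size_mergings_perm q qp).
case/andP: qn => q0 sq.
by rewrite /is_composition -(perm_all _ qp) q0 -(perm_sumn qp).
Qed.

End LieSeries.

(** * The basis of gamma words *)

Section Leading.
Variables (K : fieldType) (charK : [pchar K] =i pred0).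
Variable gamma : forall m, galg K 'S_m.
Hypothesis gammaLie : Lie_series gamma.

(* If the coefficient vanished, gamma_m would square to 0. *)
Lemma lead_neq0 m : (0 < m)%N -> lead gamma m != 0.
Proof.
move=> m0; apply/eqP=> l0; have [gin [idem gw]] := gammaLie m0.
have mm : is_composition m [:: m] by rewrite /is_composition /= m0 addn0 eqxx.
have := gamma_mul charK gammaLie mm mm (leqnn _).
rewrite big_seq1 l0 mul0r scale0r gamma_word1 // => gg0.
have a0 : m%:R^-1 *: gamma m = 0.
  by rewrite -idem -scalerAl -scalerAr gg0 !scaler0.
have: omega K m \in (<[m%:R^-1 *: gamma m]> * fullv)%VS.
  by rewrite gw -[X in X \in _]mulr1 memv_mul ?memv_line ?memvf.
rewrite a0 => /(subvP (_ : _ <= 0)%VS); rewrite memv0 (negPf (omega_neq0 K m0)).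
suff le0 : (<[0%R : galg K 'S_m]> * fullv <= 0)%VS by move/(_ le0).
by apply/prodvP=> u v /vlineP[k ->] _; rewrite scaler0 mul0r mem0v.
Qed.

Lemma prod_lead_neq0 q : all (leq 1) q -> \prod_(m <- q) lead gamma m != 0.
Proof.
elim: q => [|m q IH] /=; first by rewrite big_nil oner_neq0.
by case/andP=> m0 q0; rewrite big_cons mulf_neq0 ?lead_neq0 ?IH.
Qed.

Lemma gamma_norm_neq0 q : all (leq 1) q -> gamma_norm gamma q != 0.
Proof.
move=> q0; rewrite mulf_neq0 ?prod_lead_neq0 //.
apply: natK_neq0 => //; have := mergings_self q.
by case: (mergings q q).
Qed.

Variable n : nat.
Local Notation g := (gamma_word gamma n).

Lemma bcoef_gamma_word w v : is_composition n w -> is_composition n v ->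
  (size w <= size v)%N ->
  bcoef (compositions n) (Xi K n) w (g v) = (\prod_(m <- v) lead gamma m) * (v == w)%:R.
Proof.
move=> wn vn lewv; case/andP: (vn) => v0 /eqP sv.
rewrite gamma_word_expansion // (functional_sum (bcoef_lin _ _ _)).
rewrite -[RHS](@Xi_expansion_lead K gamma K^o (fun s => (s == w)%:R)) //.
  apply: eq_big_seq => x xv; have [xn _] := mem_Xi_expansion v0 xv; rewrite sv in xn.
  by rewrite (functionalZ (bcoef_lin _ _ _)) bcoefE ?Xi_free ?mem_compositions.
by move=> s lts; case: eqP => // e; rewrite e ltnNge lewv in lts.
Qed.

(** Among the words not longer than v, only v itself occurs in the Xi expansion of gamma_v, so the
    system is triangular with respect to length. *)
Lemma gamma_word_free : free (map g (compositions n)).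
Proof.
apply: free_map => [|c]; first exact: compositions_uniq.
apply: (@triangular_coef0 _ _ _ _
  (fun w v => bcoef (compositions n) (Xi K n) w (g v)) size).
- exact: compositions_uniq.
- move=> w _ e; rewrite -[RHS](functional0 (bcoef_lin (compositions n) (Xi K n) w)) -e.
  rewrite (functional_sum (bcoef_lin _ _ _)); apply: eq_bigr => v _.
  by rewrite (functionalZ (bcoef_lin _ _ _)).
- move=> w; rewrite mem_compositions => wn; rewrite bcoef_gamma_word // eqxx mulr1.
  by apply: prod_lead_neq0; case/andP: wn.
move=> w v; rewrite !mem_compositions => wn vn nwv; apply: contraR;
  rewrite -leqNgt => le.
by rewrite bcoef_gamma_word // (eq_sym v) (negPf nwv) mulr0 eqxx.
Qed.

Lemma gamma_word_span : descent_alg K n = <<map g (compositions n)>>%VS.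
Proof.
apply/esym/eqP; rewrite eqEdim; apply/andP; split.
  by apply/span_subvP => _ /mapP[q _ ->]; apply: gamma_word_in.
rewrite descent_alg_span; move/eqP: gamma_word_free => ->.
by move/eqP: (Xi_free K n) => ->; rewrite !size_map.
Qed.

Lemma descent_mul_gamma x p : is_composition n p -> x \in descent_alg K n ->
  x * g p \in <<[seq g q | q <- permutations p]>>%VS.
Proof.
move=> pn; rewrite descent_alg_span => /(bcoef_sum (compositions_uniq n)) ->.
rewrite mulr_suml big_seq; apply: rpred_sum => r; rewrite mem_compositions => rn.
rewrite -scalerAl Xi_mul_gamma_word // memvZ // big_seq; apply: rpred_sum => t.
move/perm_mergings => tp; apply/memv_span/map_f.
by rewrite mem_permutations.
Qed.

End Leading.

(** * The peak algebra *)

(** Equality of peak positions for words with arbitrary letters, so that it passes to prefixes and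
    suffixes. *)
Definition same_peaks (w w' : seq nat) := size w = size w' /\
  forall i, (i.+2 < size w)%N ->
    (nth 0 w i < nth 0 w i.+1)%N && (nth 0 w i.+2 < nth 0 w i.+1)%N =
    (nth 0 w' i < nth 0 w' i.+1)%N && (nth 0 w' i.+2 < nth 0 w' i.+1)%N.

Lemma same_peaks_take m w w' : same_peaks w w' -> same_peaks (take m w) (take m w').
Proof.
case=> sw h; split; first by rewrite !size_take sw.
move=> i; rewrite size_take_min leq_min => /andP[lt2 lti].
have lt1 := ltnW lt2; have lt0 := ltnW lt1.
by rewrite !nth_take //; apply: h.
Qed.

Lemma same_peaks_drop m w w' : same_peaks w w' -> same_peaks (drop m w) (drop m w').
Proof.
case=> sw h; split; first by rewrite !size_drop sw.
by move=> i; rewrite size_drop ltn_subRL !nth_drop !addnS; apply: h.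
Qed.

Lemma same_peaks_sym w w' : same_peaks w w' -> same_peaks w' w.
Proof. by case=> sw h; split=> // i; rewrite -sw => /h->. Qed.

Lemma same_peaks_trans w1 w2 w3 : same_peaks w1 w2 -> same_peaks w2 w3 -> same_peaks
  w1 w3.
Proof.
move=> [s1 h1] [s2 h2]; split; first exact: etrans s2.
by move=> i lti; rewrite h1 // h2 // -s1.
Qed.

Lemma same_peaks_map (f : nat -> nat) w : {in w &, {mono f : i j / (i < j)%N}} ->
  same_peaks (map f w) w.
Proof.
move=> fm; split; rewrite size_map // => i lt2.
have lt1 := ltnW lt2; have lt0 := ltnW lt1.
by rewrite !(nth_map 0%N) // !fm ?mem_nth.
Qed.

Lemma Peak_word n (s : 'S_n) (i : 'I_n) : (i \in Peak s) =
  [&& (1 < i)%N, (nth 0 (word s) i.-2 < nth 0 (word s) i.-1)%N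
    & (nth 0 (word s) i < nth 0 (word s) i.-1)%N].
Proof.
have op (j : 'I_n) : (0 < j)%N -> val (ord_pred j) = j.-1.
  move=> j0; rewrite /= -{1}(prednK j0) addSn /= addnC modnDl modn_small //.
  by rewrite (leq_ltn_trans (leq_pred _)).
rewrite inE; case: ltnP => //= i1.
have e1 : val (ord_pred i) = i.-1 by rewrite op // ltnW.
have e2 : val (ord_pred (ord_pred i)) = i.-2 by rewrite op e1 // -ltnS prednK // ltnW.
by rewrite -[i.-2]e2 -[i.-1]e1 !nth_word.
Qed.

Lemma eq_Peak n (s t : 'S_n) : (Peak s = Peak t) <-> same_peaks (word s) (word t).
Proof.
split=> [e|[_ h]].
  split; rewrite !size_word // => i lti.
  have := Peak_word s (Ordinal lti); have := Peak_word t (Ordinal lti).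
  by rewrite e /= => ->.
apply/setP=> i; rewrite !Peak_word; case: i => -[|[|i]] //= lti.
by apply: h; rewrite size_word.
Qed.

(* The peak words of odd compositions: a block of odd size a contributes
   0 1 0 1 ... 0. *)
Definition peak_word (q : seq nat) : seq bool := flatten (map (mkseq odd) q).

Lemma mkseq_oddSS a : mkseq odd a.+2 = [:: false, true & mkseq odd a].
Proof.
rewrite /mkseq /= (iotaDl 2 0) -map_comp; congr [:: _, _ & _].
by apply: eq_map => i /=; rewrite negbK.
Qed.

(** Read from the left: a leading 0 1 enlarges the first block of the rest by two, while a 0
    followed by another 0, or by nothing, is a block of size 1. *)
Lemma peak_wordP (b : seq bool) : b != [::] -> head true b = false -> last true b =
  false ->
  sorted (fun x y => ~~ (x && y)) b ->
  exists q, [/\ all odd q, sumn q = size b & peak_word q = b].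
Proof.
have [m] := ubnP (size b); elim: m b => // m IH [//|a b] ltm _ /= ->.
case: b ltm => [|[] b] ltm.
- by move=> _ _; exists [:: 1%N].
- move=> lb /= srt; case: b ltm lb srt => [//|d b] ltm lb /= /andP[nd srt].
  have [|||q [q0 sq qb]] := IH (d :: b) _ _ _ lb srt => //.
  + by rewrite -ltnS (leq_trans _ ltm).
  + exact: negbTE.
  case: q q0 sq qb => [//|c q] /= /andP[c0 q0] sq qb.
  exists (c.+2 :: q); split; rewrite /= ?negbK ?c0 ?q0 //.
    by rewrite !addSn sq.
  by rewrite -[LHS]/(mkseq odd c.+2 ++ peak_word q) mkseq_oddSS -qb.
move=> lb srt; have [||q [q0 sq qb]] := IH (false :: b) ltm _ _ lb srt => //.
by exists (1%N :: q); rewrite /= q0 sq /peak_word /= -qb.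
Qed.

Section PeakAlgebra.
Variables (K : fieldType) (n : nat).
Local Notation KS := (galg K 'S_n).

Lemma Peak_sumE P (s : 'S_n) : Peak_sum K P s = (Peak s == P)%:R.
Proof. exact: galg_fiberE. Qed.

Lemma peak_algP (x : KS) :
  reflect (forall s t : 'S_n, Peak s = Peak t -> x s = x t) (x \in peak_alg K n).
Proof.
apply: (iffP idP) => [xin s t e|xP].
  rewrite (coord_span (X := in_tuple _) xin) !galg_sumE; apply: eq_bigr => i _.
  rewrite !ffunE; congr (_ * _); have : (in_tuple
    [seq Peak_sum K P | P : {set 'I_n}])`_i
    \in [seq Peak_sum K P | P : {set 'I_n}] by apply: mem_nth.
  by case/imageP=> P _ ->; rewrite !Peak_sumE e.
pose c (P : {set 'I_n}) : K := if [pick s : 'S_n | Peak s == P] is Some s then x s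
  else 0.
have -> : x = \sum_P c P *: Peak_sum K P.
  apply/ffunP=> s; rewrite galg_sumE (bigD1 (Peak s)) //= ffunE Peak_sumE eqxx.
  rewrite big1 => [|P nP]; last by rewrite ffunE Peak_sumE eq_sym (negPf nP);
    apply: mulr0.
  rewrite addr0 /c; case: pickP => [t /eqP /xP->|/(_ s)]; last by rewrite eqxx.
  exact/esym/mulr1.
by apply: memv_suml => P _; apply/memvZ/memv_span/imageP; exists P.
Qed.

Definition odd_compositions := [seq q <- compositions n | all odd q].

(** The indicator sequence of the peaks of a permutation is 0 at both ends and has no two adjacent
    ones, so it is the peak word of an odd composition. Sets that are not peak sets contribute the
    zero vector. *)
Lemma dim_peak_alg : (0 < n)%N -> (\dim (peak_alg K n) <= size odd_compositions)%N.
Proof.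
(* A member i of a peak set refers to the letter at position i-1 counted from 0. *)
move=> n0; pose pk q := [set i : 'I_n | (0 < i)%N && nth false (peak_word q) i.-1].
have -> : size odd_compositions = size [seq Peak_sum K (pk q) | q <- odd_compositions].
  by rewrite size_map.
apply: leq_trans (dim_span _); apply/dimvS/span_subvP => _ /imageP[P _ ->].
case: (pickP (fun s : 'S_n => Peak s == P)) => [s /eqP sP|nP]; last first.
  have -> : Peak_sum K P = 0; last exact: mem0v.
  by apply/ffunP=> s; rewrite Peak_sumE nP ffunE.
pose w := word s.
pose b := mkseq (fun j => [&& (0 < j)%N, (j.+1 < n)%N, (nth 0 w j.-1 < nth 0 w j)%N
  & (nth 0 w j.+1 < nth 0 w j)%N]) n.
have sb : size b = n by rewrite size_mkseq.
have [||||q [q0 sq qb]] := @peak_wordP b.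
- by rewrite -size_eq0 sb -lt0n.
- by rewrite -nth0 (set_nth_default false) ?sb // nth_mkseq.
- by rewrite -nth_last (set_nth_default false) ?sb ?prednK // nth_mkseq ?prednK //
  ltnn !andbF.
- apply/(sortedP false) => i; rewrite sb => lti; rewrite !nth_mkseq ?(ltnW lti) //.
  apply/negP=> /andP[/and4P[_ _ _ h1] /and4P[_ _ h2 _]].
  by move: (ltn_trans h1 h2); rewrite ltnn.
have -> : P = pk q.
  apply/setP=> i; rewrite -sP Peak_word inE qb; case: i => -[|i] //= lti.
  rewrite nth_mkseq ?(ltnW lti) // lti /=; case: i lti => //.
apply/memv_span/map_f; rewrite mem_filter q0 mem_compositions /is_composition sq sb
  eqxx andbT.
by apply/allP=> a /(allP q0) /odd_gt0.
Qed.

End PeakAlgebra.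

Section PeakLieSeries.
Variables (K : fieldType) (charK : [pchar K] =i pred0) (gamma : forall m, galg K 'S_m).
Hypotheses (gammaLie : Lie_series gamma)
  (gammaPeak : forall m, odd m -> gamma m \in peak_alg K m).

(** Both words are standardized, which preserves their peaks; then gamma_m takes equal values at the
    two permutations because it lies in the peak algebra. *)
Lemma wgamma_peak m w w' : odd m -> uniq w -> uniq w' -> same_peaks w w' ->
  wgamma gamma m w = wgamma gamma m w'.
Proof.
move=> om uw uw' ww'; have [sw _] := ww'.
have [sm|sm] := eqVneq (size w) m; last by rewrite !wgamma_graded // -sw.
have [s [f ws fm]] := standardization uw sm.
have [t [f' wt fm']] := standardization uw' (etrans (esym sw) sm).
have fms : {in word s &, {mono f : i j / (i < j)%N}}.
  by move=> i j; rewrite !mem_word; apply: fm.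
have fmt : {in word t &, {mono f' : i j / (i < j)%N}}.
  by move=> i j; rewrite !mem_word; apply: fm'.
rewrite /wgamma ws wt !wf_mono // !wf_word ?gamma_in ?odd_gt0 //.
apply: (elimT (@peak_algP _ m (gamma m)) (gammaPeak om)); apply/eq_Peak.
apply: same_peaks_trans (same_peaks_sym (same_peaks_map fms)) _.
by rewrite -ws; apply: same_peaks_trans ww' _; rewrite wt; apply: same_peaks_map.
Qed.

Lemma wprod_peak q w w' : all odd q -> uniq w -> uniq w' -> same_peaks w w' ->
  wprod (wgamma gamma) q w = wprod (wgamma gamma) q w'.
Proof.
elim: q w w' => [|m q IH] w w' /=.
  by move=> _ _ _ [sw _]; rewrite -!size_eq0 sw.
case/andP=> om oq uw uw' ww'; have [sw _] := ww'.
rewrite !(cut_prod_homog _ _ (@wgamma_graded _ gamma m)) -sw; case: ifP => // _.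
rewrite (wgamma_peak om _ _ (same_peaks_take m ww')) ?take_uniq //.
by rewrite (IH _ _ oq _ _ (same_peaks_drop m ww')) ?drop_uniq.
Qed.

Variable n : nat.
Local Notation odd_compositions := (odd_compositions n).

Lemma gamma_word_peak q : q \in odd_compositions -> gamma_word gamma n q \in peak_alg
  K n.
Proof.
rewrite mem_filter mem_compositions => /andP[oq qn]; apply/peak_algP=> s t /eq_Peak st.
by rewrite !gamma_wordE //; apply: wprod_peak; rewrite ?word_uniq.
Qed.

Lemma odd_gamma_word_free : free (map (gamma_word gamma n) odd_compositions).
Proof.
have := gamma_word_free charK gammaLie n.
rewrite -(perm_free (perm_map _ (permEl (perm_filterC (all odd) (compositions n))))).
by rewrite map_cat => /catl_free.
Qed.

Lemma peak_alg_span : (0 < n)%N ->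
  peak_alg K n = <<map (gamma_word gamma n) odd_compositions>>%VS.
Proof.
move=> n0; apply/esym/eqP; rewrite eqEdim; apply/andP; split.
  by apply/span_subvP => _ /mapP[q qn ->]; apply: gamma_word_peak.
by move/eqP: odd_gamma_word_free => ->; rewrite size_map dim_peak_alg.
Qed.

End PeakLieSeries.

(** * Class functions and Solomon's epimorphism *)

Lemma flatten_uniq_block (T : eqType) (us : seq (seq T)) u v x :
  uniq (flatten us) -> u \in us -> v \in us -> x \in u -> x \in v -> u = v.
Proof.
elim: us => //= w us IH; rewrite cat_uniq => /and3P[_ /hasPn dis uus].
have notin t : t \in us -> x \in w -> x \in t -> False.
  move=> tus xw xt; have /dis/negP[] : x \in flatten us by apply/flattenP; exists t.
  exact: xw.
rewrite !inE => /predU1P[->|uin] /predU1P[->|vin] xu xv //; last exact: IH.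
  by case: (notin v).
by case: (notin u).
Qed.

(* The cycles of x |-> next u x, for u the block of x, are the blocks. *)
Lemma cycle_type_exists n p : is_composition n p ->
  exists s : 'S_n, perm_eq (cycle_type s) p.
Proof.
case/andP=> p0 /eqP sp; pose us := reshape p (enum 'I_n).
have fl : flatten us = enum 'I_n by rewrite reshapeKr // sp size_enum_ord.
have sh : shape us = p by rewrite reshapeKl // sp size_enum_ord.
have ufl : uniq (flatten us) by rewrite fl enum_uniq.
have uu u : u \in us -> uniq u.
  elim: (us) ufl => //= w vs IH; rewrite cat_uniq inE => /and3P[uw _ uvs].
  by case/predU1P=> [->//|]; apply: IH.
pose blk x := nth [::] us (find (fun u => x \in u) us).
have has_blk x : has (fun u => x \in u) us.
  have : x \in flatten us by rewrite fl mem_enum.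
  by case/flattenP=> u uin xu; apply/hasP; exists u.
have blk_in x : blk x \in us by rewrite mem_nth // -has_find.
have mem_blk x : x \in blk x by apply: (nth_find [::] (has_blk x)).
have blkE u x : u \in us -> x \in u -> blk x = u.
  by move=> uin xu; apply: (flatten_uniq_block ufl _ uin (mem_blk x) xu).
pose f x := next (blk x) x.
have finj : injective f.
  apply: (can_inj (g := fun y => prev (blk y) y)) => x.
  rewrite /f (blkE (blk x)) ?mem_next // prev_next //; exact: uu.
exists (perm finj).
have porbE u x : u \in us -> x \in u -> porbit (perm finj) x = [set y in u].
  move=> uin xu.
  have cyc : fcycle (perm finj) u.
    rewrite (eq_in_cycle (P := mem u) (e' := frel (next u))).
    - by apply: cycle_next; apply: uu.
    - by move=> y z yu _; rewrite /= permE /f (blkE u).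
    exact/allP.
  apply/setP=> y; rewrite inE -(fconnect_cycle cyc xu).
  apply/porbitP/idP => [[i ->]|/iter_findex <-]; first by rewrite permX fconnect_iter.
  by exists (findex (perm finj) x y); rewrite permX.
have us0 u : u \in us -> exists x, x \in u.
  move=> uin; have : size u \in p by rewrite -sh map_f.
  by move/(allP p0); case: (u) => // x v _; exists x; rewrite inE eqxx.
have perm_porb : perm_eq (enum (porbits (perm finj))) [seq [set y in u] | u <- us].
  apply: uniq_perm; first exact: enum_uniq.
    rewrite map_inj_in_uniq => [|u v uin vin /setP e].
      have : forall u, u \in us -> u != [::].
        by move=> u /us0[x]; case: (u).
      elim: (us) ufl => //= w vs IH; rewrite cat_uniq => /and3P[_ dis uvs] h.
      rewrite IH // ?andbT => [|u uin]; last by apply: h; rewrite inE uin orbT.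
      apply/negP=> win; have := h w; rewrite inE eqxx => /(_ isT).
      case: w win dis {h} => // x w win /hasPn dis _.
      have /dis : x \in flatten vs by apply/flattenP; exists (x :: w);
        rewrite ?inE ?eqxx.
      by rewrite inE eqxx.
    have [x xu] := us0 u uin; have := e x; rewrite !inE xu => /esym xv.
    exact: (flatten_uniq_block ufl uin vin xu xv).
  move=> C; rewrite mem_enum; apply/imsetP/mapP => [[x _ ->]|[u uin ->]].
    by exists (blk x) => //; apply: porbE.
  by have [x xu] := us0 u uin; exists x => //; rewrite (porbE u).
rewrite /cycle_type; apply: perm_trans (perm_map _ perm_porb) _.
rewrite -map_comp -sh /shape (eq_in_map _ size _).1 // => u uin /=.
by rewrite cardsE (card_uniqP (uu u uin)).
Qed.

Lemma partition_porbits n (s : 'S_n) : partition (porbits s) [set: 'I_n].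
Proof.
apply/and3P; split.
- rewrite eqEsubset subsetT; apply/subsetP=> x _; apply/bigcupP.
  by exists (porbit s x); [apply: imset_f | apply: porbit_id].
- apply/trivIsetP=> _ _ /imsetP[x _ ->] /imsetP[y _ ->]; apply: contraR.
  case/pred0Pn=> z /andP[/= zx zy]; apply/eqP; move: zx zy.
  by rewrite -!eq_porbit_mem => /eqP-> /eqP->.
apply/imsetP=> -[x _ e]; have := porbit_id s x.
by rewrite -e inE.
Qed.

Lemma cycle_type_composition n (s : 'S_n) : is_composition n (cycle_type s).
Proof.
have part := partition_porbits s; apply/andP; split.
  apply/allP=> a /mapP[C]; rewrite mem_enum => Cs ->.
  case/and3P: part => _ _; rewrite card_gt0; apply: contraNneq => <-; exact: Cs.
apply/eqP; rewrite sumnE big_map big_enum /= -(card_partition part).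
by rewrite cardsT card_ord.
Qed.

Lemma mem_partitions n p : (p \in partitions n) = is_composition n p && sorted geq p.
Proof. by rewrite mem_filter mem_compositions andbC. Qed.

Lemma partitions_uniq n : uniq (partitions n).
Proof. exact/filter_uniq/compositions_uniq. Qed.

Lemma geq_total : total geq. Proof. by move=> a b; apply: leq_total. Qed.
Lemma geq_trans : transitive geq. Proof. by move=> b a c ab bc;
  apply: leq_trans bc ab. Qed.
Lemma geq_anti : antisymmetric geq. Proof. by move=> a b /andP[ab ba];
  apply/anti_leq/andP. Qed.

Lemma sort_partition n q : is_composition n q -> sort geq q \in partitions n.
Proof.
move=> /andP[q0 /eqP sq]; rewrite mem_partitions /is_composition.
have pq := permEl (perm_sort geq q).
by rewrite (perm_all _ pq) q0 (perm_sumn pq) sq eqxx (sort_sorted geq_total).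
Qed.

Lemma perm_partition n p q : p \in partitions n -> q \in partitions n ->
  perm_eq p q = (p == q).
Proof.
rewrite !mem_partitions => /andP[_ ps] /andP[_ qs].
apply/idP/eqP => [|->]; last exact: perm_refl.
exact: (sorted_eq geq_trans geq_anti ps qs).
Qed.

Section ClassFunctions.
Variables (K : fieldType) (charK : [pchar K] =i pred0).
Local Notation CF n := {ffun 'S_n -> K^o}.

Lemma word_factor_neq0 q : all (leq 1) q -> (word_factor q)%:R != 0 :> K.
Proof.
move=> q0; apply: natK_neq0 => //; rewrite /word_factor big_seq.
apply: prodn_cond_gt0 => i; rewrite mem_undup => /(allP q0) i0.
by rewrite muln_gt0 fact_gt0 expn_gt0 i0.
Qed.

Lemma ch_perm n p q : perm_eq p q -> ch K n p = ch K n q.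
Proof.
move=> pq; apply/ffunP=> s; rewrite !ffunE (permPr pq); congr (_%:R * _).
rewrite /word_factor (perm_big _ (perm_undup (perm_mem pq))).
by apply: eq_bigr => i _; rewrite (seq.permP pq).
Qed.

Lemma chE n p (s : 'S_n) :
  ch K n p s = (word_factor p)%:R * (perm_eq (cycle_type s) p)%:R.
Proof. by rewrite !ffunE. Qed.

Lemma cf_sumE n (I : Type) (r : seq I) (P : pred I) (F : I -> CF n) s :
  (\sum_(i <- r | P i) F i) s = \sum_(i <- r | P i) (F i s : K).
Proof. by elim/big_rec2: _ => [|i y z _ <-]; rewrite ffunE. Qed.

Lemma ch_free n : free (map (ch K n) (partitions n)).
Proof.
apply: free_map => [|c cs w wn]; first exact: partitions_uniq.
have /andP[wc _] : is_composition n w && sorted geq w by rewrite -mem_partitions.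
have [s sw] := cycle_type_exists wc.
move/ffunP/(_ s): cs; rewrite cf_sumE (bigD1_seq w) ?partitions_uniq //=.
rewrite big1_seq => [|v /andP[nvw vn]].
  rewrite addr0 !ffunE sw => /eqP; rewrite /GRing.scale /= mulr1 mulf_eq0.
  by rewrite (negPf (word_factor_neq0 _)) ?orbF => [/eqP //|]; case/andP: wc.
rewrite !ffunE (permPl sw) (perm_partition wn vn) eq_sym (negPf nvw).
by rewrite /GRing.scale /= mulr0n !mulr0.
Qed.

Lemma triv_charE m :
  triv_char K m = \sum_(p <- partitions m) (word_factor p)%:R^-1 *: ch K m p.
Proof.
apply/ffunP=> s; rewrite cf_sumE ffunE.
have cs := cycle_type_composition s; have ps := sort_partition cs.
have pcs : perm_eq (cycle_type s) (sort geq (cycle_type s)).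
  by rewrite perm_sym; apply/permEl/perm_sort.
rewrite (bigD1_seq _ ps) ?partitions_uniq //= big1_seq => [|p /andP[np pm]].
  rewrite ffunE chE pcs mulr1 addr0 /GRing.scale /= mulVf // word_factor_neq0 //.
  by move: ps; rewrite mem_partitions => /andP[/andP[]].
rewrite ffunE chE (permPl pcs) (perm_partition ps pm) eq_sym (negPf np).
by rewrite /GRing.scale /= !mulr0.
Qed.

Lemma bcoef_triv m p : p \in partitions m ->
  bcoef (partitions m) (ch K m) p (triv_char K m) = (word_factor p)%:R^-1.
Proof.
move=> pm; rewrite triv_charE (functional_sum (bcoef_lin _ _ _)).
rewrite (bigD1_seq p) ?partitions_uniq //= (functionalZ (bcoef_lin _ _ _)).
rewrite bcoefE ?ch_free // eqxx mulr1 big1_seq ?addr0 // => q /andP[nqp qm].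
by rewrite (functionalZ (bcoef_lin _ _ _)) bcoefE ?ch_free // (negPf nqp) mulr0.
Qed.

End ClassFunctions.

(** * Evaluation of class functions in polynomials *)

Section BasisExtension.
Variables (K : fieldType) (V : vectType K) (U : lmodType K).
Variables (ws : seq (seq nat)) (b : seq nat -> V) (h : seq nat -> U).

(** The analogue of [lin_ext] for targets of infinite dimension, here the polynomial ring. *)
Definition bext (x : V) : U := \sum_(w <- ws) bcoef ws b w x *: h w.

Lemma bext_sum (I : Type) (r : seq I) (c : I -> K) (F : I -> V) :
  bext (\sum_(i <- r) c i *: F i) = \sum_(i <- r) c i *: bext (F i).
Proof.
rewrite /bext; under [RHS]eq_bigr do rewrite scaler_sumr.
rewrite [RHS]exchange_big; apply: eq_bigr => w _.
rewrite (functional_sum (bcoef_lin _ _ _)) scaler_suml; apply: eq_bigr => i _.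
by rewrite (functionalZ (bcoef_lin _ _ _)) scalerA.
Qed.

Lemma bext_basis w : uniq ws -> free (map b ws) -> w \in ws -> bext (b w) = h w.
Proof.
move=> uws fr wws; rewrite /bext (bigD1_seq w) //= bcoefE // eqxx scale1r.
rewrite big1_seq ?addr0 // => v /andP[nvw _].
by rewrite bcoefE // eq_sym (negPf nvw) scale0r.
Qed.

End BasisExtension.

Section Weight.
Variables (N : nat).

(* Reading a word as digits in base N: the weight determines the number of
   occurrences of each letter as long as words have length < N. *)
Definition weight (q : seq nat) : nat := sumn (map (expn N) q).

Lemma weight_cat p q : weight (p ++ q) = (weight p + weight q)%N.
Proof. by rewrite /weight map_cat sumn_cat. Qed.

Lemma weight_perm p q : perm_eq p q -> weight p = weight q.
Proof. by move=> pq; apply/perm_sumn/perm_map. Qed.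

Lemma weight_lt a q : (size q < N)%N -> all (geq a) q -> (weight q < N ^ a.+1)%N.
Proof.
move=> szq aq; have N0 : (0 < N)%N := leq_ltn_trans (leq0n _) szq.
apply: (@leq_ltn_trans (size q * N ^ a));
  last by rewrite expnS ltn_pmul2r ?expn_gt0 ?N0.
elim: q aq {szq} => //= b q IH /andP[ba aq]; rewrite mulSn.
by apply: leq_add (IH aq); apply: leq_pexp2l.
Qed.

(** The first letter of a partition is its leading digit; if these differ, [weight_lt] already
    separates the weights. *)
Lemma weight_inj p q : (size p < N)%N -> (size q < N)%N -> sorted geq p -> sorted geq
  q ->
  weight p = weight q -> p = q.
Proof.
have N0 m : (m < N)%N -> (0 < N)%N by apply: leq_ltn_trans.
elim: p q => [|a p IH] [|b q] //= sp sq.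
- by move=> _ _ /esym/eqP; rewrite addn_eq0 expn_eq0 -leqn0 leqNgt (N0 _ sq).
- by move=> _ _ /eqP; rewrite addn_eq0 expn_eq0 -leqn0 leqNgt (N0 _ sp).
have wlt a' b' p' q' : (size (a' :: p') < N)%N -> path geq a' p' -> (a' < b')%N ->
    (weight (a' :: p') < weight (b' :: q'))%N.
  move=> s' srt ab; apply: leq_trans (leq_trans _ (leq_addr _ _)).
    by apply: weight_lt s' _; apply/andP; split;
      [apply: leqnn | apply: (order_path_min geq_trans srt)].
  by apply: leq_pexp2l => //; apply: N0 s'.
move=> pa pb; case: (ltngtP a b) => [ab|ba|<-].
- by move=> e; have := wlt _ _ _ q sp pa ab; rewrite e ltnn.
- by move=> e; have := wlt _ _ _ p sq pb ba; rewrite e ltnn.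
move/addnI => e; congr (_ :: _); apply: IH (path_sorted pa) (path_sorted pb) e;
  exact: ltnW.
Qed.

End Weight.

Lemma size_composition n q : is_composition n q -> (size q <= n)%N.
Proof.
case/andP=> q0 /eqP <-; elim: q q0 => //= a q IH /andP[a0 /IH]; rewrite -add1n.
exact: leq_add.
Qed.

(** All letters of such a [q] are below [m], and there are fewer than [N] of them. *)
Lemma weight_composition N m q : (m < N)%N -> is_composition m q -> q != [:: m] ->
  (weight N q < N ^ m)%N.
Proof.
move=> mN qm nq; have szq := size_composition qm; case: m => [|m] in mN qm nq szq *.
  by case: q szq {qm nq} => // _; rewrite expn0.
apply: weight_lt; first exact: leq_ltn_trans mN.
case/andP: qm => q0 /eqP sq; apply/allP=> a aq; rewrite /= -ltnS ltn_neqAle.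
have pq := perm_to_rem aq; have := perm_sumn pq; rewrite sq /= => e.
have -> : (a <= m.+1)%N by rewrite e leq_addr.
rewrite andbT; apply: contraNneq nq => am; move/eqP: e.
rewrite -am -[X in X == _]addn0 eqn_add2l eq_sym => s0.
have r0 : rem a q = [::].
  have : all (leq 1) (rem a q) by apply/allP=> b /mem_rem /(allP q0).
  by case: (rem a q) s0 => //= b l; rewrite addn_eq0 => /andP[/eqP->].
by rewrite r0 in pq; apply/eqP; apply: perm_small_eq pq.
Qed.

Section Evaluation.
Variables (K : fieldType) (charK : [pchar K] =i pred0) (N : nat).
Local Notation CF n := {ffun 'S_n -> K^o}.
Local Notation KS n := (galg K 'S_n).

Definition cf_eval m : CF m -> {poly K} :=
  bext (partitions m) (ch K m) (fun p => 'X^(weight N p)).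

Lemma cf_eval_ch m q : is_composition m q -> cf_eval (ch K m q) = 'X^(weight N q).
Proof.
move=> qm; have pq : perm_eq q (sort geq q) by rewrite perm_sym; apply/permEl/perm_sort.
rewrite (ch_perm _ _ pq) (weight_perm _ pq).
by rewrite [LHS]bext_basis ?partitions_uniq ?ch_free ?sort_partition.
Qed.

Lemma cf_prodE k l (x : CF k) (y : CF l) :
  cf_prod x y = \sum_(r <- partitions k) bcoef (partitions k) (ch K k) r x *:
    \sum_(q <- partitions l) bcoef (partitions l) (ch K l) q y *: ch K (k + l) (r ++ q).
Proof.
rewrite /cf_prod /concat_prod lin_extE ?partitions_uniq //.
by apply: eq_bigr => r _; rewrite lin_extE ?partitions_uniq.
Qed.

Lemma cf_eval_prod k l (x : CF k) (y : CF l) :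
  cf_eval (cf_prod x y) = cf_eval x * cf_eval y.
Proof.
rewrite cf_prodE [LHS]bext_sum /cf_eval /bext mulr_suml; apply: eq_big_seq => r.
rewrite mem_partitions => /andP[rk _]; rewrite -scalerAl -/(bext _ _ _ _);
  congr (_ *: _).
rewrite [LHS]bext_sum mulr_sumr; apply: eq_big_seq => q.
rewrite mem_partitions => /andP[ql _]; rewrite -scalerAr; congr (_ *: _).
by rewrite -/(cf_eval _) cf_eval_ch ?is_composition_cat // weight_cat exprD.
Qed.

Lemma cf_prod_in k l (x : CF k) (y : CF l) :
  cf_prod x y \in <<map (ch K (k + l)%N) (partitions (k + l)%N)>>%VS.
Proof.
rewrite cf_prodE big_seq; apply: rpred_sum => r; rewrite mem_partitions => /andP[rk _].
rewrite memvZ // big_seq; apply: rpred_sum => q; rewrite mem_partitions => /andP[ql _].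
have rq := is_composition_cat rk ql; rewrite memvZ // memv_span //.
have pq : perm_eq (r ++ q) (sort geq (r ++ q)).
  by rewrite perm_sym; apply/permEl/perm_sort.
by rewrite (ch_perm _ _ pq) map_f // sort_partition.
Qed.

Definition triv_eval a : {poly K} := cf_eval (triv_char K a).

Definition triv_word n q : CF n := component (V := fun n => CF n) n
  (word_prod (V := fun n => CF n) (@cf_prod K) (ch K 0 [::]) (triv_char K) q).

Lemma cf_eval_word n q : sumn q = n -> cf_eval (triv_word n q) = \prod_(a <- q)
  triv_eval a.
Proof.
move=> sq; case: n / sq; rewrite /triv_word (@component_id K (fun n => CF n)).
elim: q => [|a q IH] /=; first by rewrite cf_eval_ch // big_nil.
by rewrite cf_eval_prod IH big_cons.
Qed.

Lemma triv_word_in n q : triv_word n q \in <<map (ch K n) (partitions n)>>%VS.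
Proof.
rewrite /triv_word /component; case: eqP => [e|_]; last exact: mem0v.
case: n / e; case: q => [|a q]; last exact: cf_prod_in.
by apply/memv_span/map_f; rewrite mem_partitions.
Qed.

(** This is [cf_eval] after [solomon], as [cf_eval_solomon] shows. On Xi^q it is a product over
    letters, hence multiplicative for the outer product. *)
Definition descent_eval n : KS n -> {poly K} :=
  bext (compositions n) (Xi K n) (fun q => \prod_(a <- q) triv_eval a).

Lemma solomonE n (x : KS n) :
  solomon x = \sum_(q <- compositions n) bcoef (compositions n) (Xi K n) q x *:
    triv_word n q.
Proof. by rewrite /solomon lin_extE ?compositions_uniq. Qed.

Lemma cf_eval_solomon n (x : KS n) : cf_eval (solomon x) = descent_eval x.
Proof.
rewrite solomonE [LHS]bext_sum; apply: eq_big_seq => q.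
by rewrite mem_compositions => /andP[_ /eqP sq]; rewrite -/(cf_eval _) cf_eval_word.
Qed.

Lemma cf_eval_inj n (x : CF n) : (n < N)%N ->
  x \in <<map (ch K n) (partitions n)>>%VS -> cf_eval x = 0 -> x = 0.
Proof.
move=> ltn xin; rewrite /cf_eval /bext => ex.
rewrite (bcoef_sum (partitions_uniq n) xin) big1_seq // => p /andP[_ pn].
have -> : bcoef (partitions n) (ch K n) p x = 0; last by rewrite scale0r.
move/polyP/(_ (weight N p)): ex; rewrite coef_sum coef0 => <-.
rewrite (bigD1_seq p) ?partitions_uniq //= coefZ coefXn eqxx mulr1.
rewrite big1_seq ?addr0 // => q /andP[nqp qn]; rewrite coefZ coefXn.
case: eqP => [e|]; last by rewrite mulr0.
move: pn qn; rewrite !mem_partitions => /andP[/size_composition pn ps]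
  /andP[/size_composition qn qs].
case/eqP: nqp; apply/esym; apply: weight_inj ps qs e; exact: leq_ltn_trans ltn.
Qed.

Lemma mem_ker_solomon n (x : KS n) : (n < N)%N ->
  (x \in ker_solomon K n) = (x \in descent_alg K n) && (descent_eval x == 0).
Proof.
move=> ltn; rewrite memv_cap memv_ker lfunE /=; congr (_ && _).
apply/eqP/eqP => [e|]; rewrite -cf_eval_solomon.
  by rewrite [solomon x]e /cf_eval /bext big1 // => p _;
    rewrite (functional0 (bcoef_lin _ _ _)) scale0r.
apply: cf_eval_inj => //; rewrite solomonE; apply: rpred_sum => q _.
by rewrite memvZ // triv_word_in.
Qed.

Lemma descent_eval_prod k l (x : KS k) (y : KS l) :
  descent_eval (outer_prod x y) = descent_eval x * descent_eval y.
Proof.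
rewrite outer_prodE; under eq_bigr do under eq_bigr do rewrite -scalerA.
under eq_bigr do rewrite -scaler_sumr.
rewrite [LHS]bext_sum [descent_eval x]/descent_eval {2}/bext mulr_suml.
apply: eq_big_seq => r; rewrite mem_compositions => rk; rewrite -scalerAl;
  congr (_ *: _).
rewrite [LHS]bext_sum [descent_eval y]/descent_eval {2}/bext mulr_sumr.
apply: eq_big_seq => q; rewrite mem_compositions => ql; rewrite -scalerAr;
  congr (_ *: _).
rewrite [LHS]bext_basis ?compositions_uniq ?Xi_free ?mem_compositions
  ?is_composition_cat //.
by rewrite big_cat.
Qed.

Variable gamma : forall m, KS m.

Lemma descent_eval_word n q : sumn q = n ->
  descent_eval (gamma_word gamma n q) = \prod_(m <- q) descent_eval (gamma m).
Proof.
move=> sq; case: n / sq; rewrite /gamma_word component_id.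
elim: q => [|a q IH] /=; last by rewrite descent_eval_prod IH big_cons.
by rewrite [LHS]bext_basis ?compositions_uniq ?Xi_free ?mem_compositions // !big_nil.
Qed.

(** The class of the full cycles gives the term X^(N^a) with coefficient 1/a; every other cycle type
    has smaller weight. *)
Lemma size_triv_eval a : (0 < a < N)%N -> size (triv_eval a) = (N ^ a).+1.
Proof.
case/andP=> a0 aN; have aa : [:: a] \in partitions a.
  by rewrite mem_partitions /is_composition /= a0 addn0 eqxx.
rewrite /triv_eval /cf_eval /bext (bigD1_seq _ aa) ?partitions_uniq //=.
have c0 : bcoef (partitions a) (ch K a) [:: a] (triv_char K a) != 0.
  by rewrite bcoef_triv // invr_eq0 word_factor_neq0 //= a0.
rewrite size_polyDl size_scale ?size_polyXn /weight /= ?addn0 //.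
rewrite ltnS big_seq_cond; apply: (leq_trans (size_sum _ _ _));
  apply/bigmax_leqP_seq => p pa /andP[_ np].
rewrite (leq_trans (size_scale_leq _ _)) // size_polyXn weight_composition //.
by move: pa; rewrite mem_partitions => /andP[].
Qed.

Lemma size_prod_pow (f : nat -> {poly K}) q :
  (forall a, a \in q -> size (f a) = (N ^ a).+1) ->
  size (\prod_(a <- q) f a) = (weight N q).+1.
Proof.
move=> fs; rewrite size_prod_seq => [|a aq]; last by rewrite -size_poly_eq0 fs.
rewrite (eq_big_seq _ fs); under eq_bigr do rewrite -add1n.
rewrite big_split /= sum1_size -addnS addKn /weight sumnE big_map //.
Qed.

(** Each Xi^q is sent to a polynomial of degree [weight N q], which is largest for q = m alone, and
    Xi^m has nonzero coefficient in gamma_m by [lead_neq0]. *)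
Lemma size_descent_eval m : Lie_series gamma -> (0 < m < N)%N ->
  size (descent_eval (gamma m)) = (N ^ m).+1.
Proof.
move=> gL /andP[m0 mN]; have mm : is_composition m [:: m].
  by rewrite /is_composition /= m0 addn0 eqxx.
rewrite /descent_eval /bext (bigD1_seq [:: m]) ?compositions_uniq ?mem_compositions //=.
have szt q : is_composition m q -> size (\prod_(a <- q) triv_eval a) = (weight N q).+1.
  case/andP=> q0 /eqP sq; apply: size_prod_pow => a aq; rewrite size_triv_eval //.
  rewrite (allP q0 a aq) (leq_ltn_trans _ mN) // -sq.
  by have := perm_sumn (perm_to_rem aq) => ->; apply: leq_addr.
have c0 : bcoef (compositions m) (Xi K m) [:: m] (gamma m) != 0 by apply: lead_neq0.
rewrite size_polyDl size_scale ?szt // /weight /= ?addn0 //.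
rewrite ltnS big_seq_cond; apply: (leq_trans (size_sum _ _ _)).
apply/bigmax_leqP_seq => q qm /andP[_ nq]; rewrite mem_compositions in qm.
by rewrite (leq_trans (size_scale_leq _ _)) // szt // weight_composition.
Qed.

Lemma size_descent_eval_word n q : Lie_series gamma -> (n < N)%N -> is_composition n
  q ->
  size (descent_eval (gamma_word gamma n q)) = (weight N q).+1.
Proof.
move=> gL ltn /andP[q0 /eqP sq]; rewrite descent_eval_word //;
  apply: size_prod_pow => a aq.
apply: size_descent_eval => //; rewrite (allP q0 a aq) (leq_ltn_trans _ ltn) // -sq.
by rewrite (perm_sumn (perm_to_rem aq)); apply: leq_addr.
Qed.

End Evaluation.

(** * Radicals *)

Lemma directv_seq (K : fieldType) (V : vectType K) (r : seq (seq nat))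
    (U : seq nat -> {vspace V}) : uniq r ->
  (forall v : seq nat -> V, (forall p, p \in r -> v p \in U p) ->
     \sum_(p <- r) v p = 0 -> forall p, p \in r -> v p = 0) ->
  directv (\sum_(p <- r) U p).
Proof.
move=> ur h; have : directv (\sum_(i < size r) U (tnth (in_tuple r) i)).
  apply/directv_sum_independent => us Uus us0 i _.
  pose v p := \sum_(j < size r | tnth (in_tuple r) j == p) us j.
  have vi (j : 'I_(size r)) : v (tnth (in_tuple r) j) = us j.
    rewrite /v (bigD1 j) //= big1 ?addr0 // => l /andP[/eqP e] /negP[].
    by rewrite -val_eqE /= -(nth_uniq [::] _ _ ur) // -!(tnth_nth [::] (in_tuple r)) e.
  rewrite -vi; apply: h; last exact: mem_tnth.
    by move=> p /(tnthP (in_tuple r))[j ->]; rewrite vi; apply: Uus.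
  by rewrite big_tnth -[RHS]us0; apply: eq_bigr => j _; apply: vi.
by rewrite !directvE /= !(big_tnth _ _ r).
Qed.

Lemma memv_sum_seq (K : fieldType) (V : vectType K) (r : seq (seq nat))
    (v : seq nat -> V) (U : seq nat -> {vspace V}) :
  (forall p, p \in r -> v p \in U p) ->
  \sum_(p <- r) v p \in (\sum_(p <- r) U p)%VS.
Proof.
elim: r => [|p r IH] vU; first by rewrite !big_nil mem0v.
rewrite !big_cons memv_add ?vU ?mem_head // IH // => q qr.
by rewrite vU // inE qr orbT.
Qed.

Section Radicals.
Variables (K : fieldType) (charK : [pchar K] =i pred0).
Variable gamma : forall m, galg K 'S_m.
Hypotheses (gammaLie : Lie_series gamma)
  (gammaPeak : forall m, odd m -> gamma m \in peak_alg K m).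
Variables (n : nat) (n_gt0 : (0 < n)%N).
Local Notation g := (gamma_word gamma n).
Local Notation Q := (odd_compositions n).
Local Notation Dn := (descent_alg K n).
Local Notation Pn := (peak_alg K n).
Local Notation kerc := (ker_solomon K n).
Local Notation L p := (Dn * <[g p]>)%VS.
Local Notation KS := (galg K 'S_n).
Implicit Types (p q r t : seq nat) (x y : KS).

Lemma odd_compositionP q : (q \in Q) = all odd q && is_composition n q.
Proof. by rewrite mem_filter mem_compositions. Qed.

Lemma odd_composition_comp q : q \in Q -> is_composition n q.
Proof. by rewrite odd_compositionP => /andP[]. Qed.

Lemma odd_compositions_uniq : uniq Q.
Proof. exact/filter_uniq/compositions_uniq. Qed.

Lemma odd_composition_perm p q : p \in Q -> perm_eq q p -> q \in Q.
Proof.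
rewrite !odd_compositionP /is_composition => /andP[po /andP[p0 sp]] qp.
by rewrite !(perm_all _ qp) po p0 (perm_sumn qp).
Qed.

Lemma odd_partitions_uniq : uniq (odd_partitions n).
Proof. exact/filter_uniq/partitions_uniq. Qed.

Lemma odd_partitionP p : (p \in odd_partitions n) = (p \in Q) && sorted geq p.
Proof. by rewrite mem_filter mem_partitions odd_compositionP andbA. Qed.

Lemma composition_perm p q : is_composition n p -> perm_eq q p -> is_composition n q.
Proof. by move=> /andP[p0 sp] qp; rewrite /is_composition (perm_all _ qp) p0
  (perm_sumn qp). Qed.

(** For the inclusion from right to left, gamma_q is recovered from gamma_q gamma_p by dividing by
    the nonzero [gamma_norm]. *)
Lemma LambdaE p : is_composition n p -> L p = <<[seq g q | q <- permutations p]>>%VS.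
Proof.
move=> pn; apply/eqP; rewrite eqEsubv; apply/andP; split.
  apply/prodvP=> x y xD /vlineP[k ->]; rewrite -scalerAr memvZ //.
  exact: descent_mul_gamma.
apply/span_subvP => z /mapP[q]; rewrite mem_permutations => qp ->.
have qn := composition_perm pn qp; have q0 : all (leq 1) q by case/andP: qn.
have -> : g q = (gamma_norm gamma q)^-1 *: (g q * g p).
  by rewrite gamma_mul_perm // scalerA mulVf ?scale1r // gamma_norm_neq0.
by rewrite memvZ // memv_mul ?gamma_word_in ?memv_line.
Qed.

Lemma Lambda_span p x : is_composition n p -> x \in L p ->
  x = \sum_(q <- permutations p) bcoef (permutations p) g q x *: g q.
Proof. by move=> pn; rewrite LambdaE //; apply/bcoef_sum/permutations_uniq. Qed.

Lemma gamma_in_Lambda p q : is_composition n p -> perm_eq q p -> g q \in L p.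
Proof.
by move=> pn qp; rewrite LambdaE // memv_span // map_f // mem_permutations.
Qed.

Lemma descent_mul_Lambda p x y : is_composition n p -> x \in Dn -> y \in L p -> x * y
  \in L p.
Proof.
move=> pn xD /(Lambda_span pn) ->; rewrite mulr_sumr big_seq; apply: rpred_sum => q.
rewrite mem_permutations => qp; rewrite -scalerAr memvZ // LambdaE //.
have qn := composition_perm pn qp; have := descent_mul_gamma charK gammaLie qn xD.
rewrite (eq_span (Y := [seq g t | t <- permutations p])) // => z.
by apply/mapP/mapP => -[t tq ->]; exists t => //; move: tq;
  rewrite !mem_permutations (permPr qp).
Qed.

Lemma peak_span x : x \in Pn -> x = \sum_(q <- Q) bcoef Q g q x *: g q.
Proof.
by rewrite (peak_alg_span charK gammaLie gammaPeak n_gt0);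
  apply/bcoef_sum/odd_compositions_uniq.
Qed.

Lemma descent_span x : x \in Dn ->
  x = \sum_(q <- compositions n) bcoef (compositions n) g q x *: g q.
Proof. by rewrite (gamma_word_span charK gammaLie);
  apply/bcoef_sum/compositions_uniq. Qed.

Lemma peak_sub_descent : (Pn <= Dn)%VS.
Proof.
rewrite (peak_alg_span charK gammaLie gammaPeak n_gt0).
by apply/span_subvP => _ /mapP[q _ ->]; apply: gamma_word_in.
Qed.

Lemma Lambda_sub_peak p : p \in Q -> (L p <= Pn)%VS.
Proof.
move=> pQ; have pn := odd_composition_comp pQ.
rewrite LambdaE //; apply/span_subvP => z /mapP[q]; rewrite mem_permutations => qp ->.
by apply: (gamma_word_peak gammaLie gammaPeak); apply: odd_composition_perm qp.
Qed.

(** * Class sums and the characters they define *)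

Definition class_sum p x : K := \sum_(q <- Q | perm_eq q p) bcoef Q g q x.

Lemma class_sum_lin p : linear (class_sum p : KS -> K^o).
Proof.
move=> k x y; rewrite /class_sum scaler_sumr -big_split; apply: eq_bigr => q _.
exact: bcoef_lin.
Qed.

HB.instance Definition _ p :=
  GRing.isLinear.Build K KS K^o _ (class_sum p) (class_sum_lin p).

Let csZ p := functionalZ (class_sum_lin p).
Let cs0 p := functional0 (class_sum_lin p).
Let cs_sum p := functional_sum (class_sum_lin p).

Lemma odd_free : free (map g Q).
Proof. exact: odd_gamma_word_free. Qed.

Lemma class_sum_gamma p q : q \in Q -> class_sum p (g q) = (perm_eq q p)%:R.
Proof.
move=> qQ; rewrite /class_sum; case: (boolP (perm_eq q p)) => qp; last first.
  rewrite big1_seq // => t /andP[tp _]; rewrite bcoefE ?odd_free //.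
  by case: eqP => // e; rewrite e tp in qp.
rewrite big_mkcond (bigD1_seq q) ?odd_compositions_uniq //= qp bcoefE ?odd_free // eqxx.
rewrite big1_seq ?addr0 // => t /andP[ntq _];
  rewrite bcoefE ?odd_free // eq_sym (negPf ntq).
by case: ifP.
Qed.

(** For all t ~ p, gamma_q gamma_t is the same multiple of gamma_q, so left multiplication by
    gamma_q collapses Lambda^p to a line and sees [y] only through its class sum. *)
Lemma gamma_mul_Lambda p q y : p \in Q -> perm_eq q p -> y \in L p ->
  g q * y = (gamma_norm gamma q * class_sum p y) *: g q.
Proof.
move=> pQ qp; have pn := odd_composition_comp pQ.
move/(Lambda_span pn) ->; rewrite cs_sum mulr_sumr mulr_sumr scaler_suml.
apply: eq_big_seq => t; rewrite mem_permutations => tp.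
rewrite csZ class_sum_gamma ?tp ?(odd_composition_perm pQ tp) // mulr1 -scalerAr.
rewrite gamma_mul_perm ?(permPr tp) // ?(composition_perm pn qp) //.
  by rewrite scalerA mulrC.
Qed.

(* Since g_p g_r = 0 when r is shorter than p, the class sum of g_r y is killed
   by multiplying with g_p from the left. *)
Lemma class_sum_mul_neq p r y : p \in Q -> is_composition n r -> ~~ perm_eq r p ->
  y \in L p -> class_sum p (g r * y) = 0.
Proof.
move=> pQ rn nrp yL; have pn := odd_composition_comp pQ.
have [lepr|ltrp] := leqP (size p) (size r).
  rewrite (Lambda_span pn yL) mulr_sumr big1_seq ?cs0 // => t.
  rewrite mem_permutations => /andP[_ tp]; rewrite -scalerAr gamma_mul_eq0 ?scaler0 //.
  - exact: composition_perm tp.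
  - by rewrite (perm_size tp).
  - by rewrite (permPr tp).
have zL : g r * y \in L p by rewrite descent_mul_Lambda ?gamma_word_in.
have := gamma_mul_Lambda pQ (perm_refl p) zL.
rewrite mulrA gamma_mul_eq0 // ?(ltnW ltrp) //; last by rewrite perm_sym.
rewrite mul0r => /esym/eqP; rewrite scaler_eq0 mulf_eq0
  (negPf (gamma_norm_neq0 _ _ _)) //=.
  case/orP=> /eqP // gp0; have := class_sum_gamma p pQ.
  by rewrite gp0 cs0 perm_refl => /eqP; rewrite eq_sym oner_eq0.
by case/andP: pn.
Qed.

(** Evaluate gamma_q gamma_p gamma_q with both bracketings and cancel one factor. *)
Lemma gamma_norm_perm p q : p \in Q -> perm_eq q p -> gamma_norm gamma q = gamma_norm
  gamma p.
Proof.
move=> pQ qp; have pn := odd_composition_comp pQ.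
have qn := composition_perm pn qp.
have q0 : gamma_norm gamma q != 0 by rewrite gamma_norm_neq0 //; case/andP: qn.
have : g q * g p * g q = g q * (g p * g q) by rewrite mulrA.
rewrite !gamma_mul_perm // 1?perm_sym // -scalerAl -scalerAr !gamma_mul_perm //
  1?perm_sym //.
move/(congr1 (class_sum p)); rewrite !csZ class_sum_gamma
  ?(odd_composition_perm pQ qp) //.
rewrite qp !mulr1 [RHS]mulrC; exact: mulfI.
Qed.

(** The scalar by which [x] acts on class sums. It uses the basis of D_n, as [x] need not lie in
    P_n. *)
Definition class_char p x : K :=
  gamma_norm gamma p * \sum_(q <- compositions n | perm_eq q p) bcoef
    (compositions n) g q x.

(** By bilinearity, take gamma_r and gamma_t. If t is not ~ p, the product stays in Lambda^t and has
    class sum 0; if t ~ p, it is governed by [class_sum_mul_neq] or [gamma_mul_perm], according to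
    whether r ~ p. *)
Lemma class_sum_mul p x y : p \in Q -> x \in Dn -> y \in Pn ->
  class_sum p (x * y) = class_char p x * class_sum p y.
Proof.
move=> pQ xD yP; rewrite {1}(descent_span xD) {1}(peak_span yP) mulr_suml cs_sum.
rewrite [class_char p x]mulr_sumr mulr_suml [RHS]big_mkcond; apply: eq_big_seq => r.
rewrite mem_compositions => rn; rewrite -scalerAl csZ [g r * _]mulr_sumr cs_sum.
transitivity (bcoef (compositions n) g r x *
  \sum_(t <- Q | perm_eq t p) bcoef Q g t y * class_sum p (g r * g t)).
  congr (_ * _); rewrite [RHS]big_mkcond; apply: eq_big_seq => t tQ.
  rewrite -scalerAr csZ; case: ifP => // ntp.
  have tn := odd_composition_comp tQ.
  have := descent_mul_gamma charK gammaLie tn (gamma_word_in gamma n r).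
  rewrite -LambdaE // => /(Lambda_span tn) ->; rewrite cs_sum big1_seq ?mulr0 // => s.
  rewrite mem_permutations => /andP[_ st];
    rewrite csZ class_sum_gamma ?(odd_composition_perm tQ st) //.
  by rewrite (permPl st) ntp mulr0.
case: ifP => rp; last first.
  rewrite big1 ?mulr0 // => t tp; rewrite class_sum_mul_neq ?mulr0 ?rp //.
  by apply: gamma_in_Lambda => //; apply: odd_composition_comp.
rewrite -[RHS]mulrA [RHS]mulrCA [class_sum p y]/class_sum [in RHS]mulr_sumr.
congr (_ * _); apply: eq_bigr => t tp; rewrite gamma_mul_perm //; last first.
  by rewrite (permPl rp) perm_sym.
by rewrite csZ class_sum_gamma ?(odd_composition_perm pQ rp) // rp mulr1
  (gamma_norm_perm pQ rp) mulrC.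
Qed.

(** Both sides equal the class sum of x gamma_p, with [x] expanded once in the basis of D_n and once
    in that of P_n. *)
Lemma class_charE p x : p \in Q -> x \in Pn ->
  class_char p x = gamma_norm gamma p * class_sum p x.
Proof.
move=> pQ xP; have pP : g p \in Pn by apply: (gamma_word_peak gammaLie gammaPeak).
have pn := odd_composition_comp pQ.
have := class_sum_mul pQ (subvP peak_sub_descent x xP) pP.
rewrite class_sum_gamma // perm_refl mulr1 => <-.
rewrite {1}(peak_span xP) mulr_suml cs_sum [RHS]mulr_sumr [RHS]big_mkcond.
apply: eq_big_seq => q qQ; rewrite -scalerAl csZ.
have qn := odd_composition_comp qQ.
case: (boolP (perm_eq q p)) => qp.
  by rewrite gamma_mul_perm // csZ class_sum_gamma // qp mulr1
    (gamma_norm_perm pQ qp) mulrC.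
by rewrite class_sum_mul_neq ?mulr0 // gamma_in_Lambda.
Qed.

Lemma peak_mul x y : x \in Dn -> y \in Pn -> x * y \in Pn.
Proof.
move=> xD yP; rewrite (peak_span yP) mulr_sumr big_seq; apply: rpred_sum => q qQ.
rewrite -scalerAr memvZ //; apply: (subvP (Lambda_sub_peak qQ)).
by rewrite memv_mul ?memv_line.
Qed.

Lemma eval_gamma_perm p q : is_composition n p -> perm_eq q p ->
  descent_eval n.+1 (g q) = descent_eval n.+1 (g p).
Proof.
move=> pn qp; have /andP[_ /eqP sp] := pn.
have /andP[_ /eqP sq] := composition_perm pn qp.
by rewrite !descent_eval_word //; apply: perm_big.
Qed.

Lemma eval_gamma_neq0 p : is_composition n p -> descent_eval n.+1 (g p) != 0.
Proof. by move=> pn; rewrite -size_poly_eq0 size_descent_eval_word. Qed.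

(** All gamma_t with t ~ p have the same evaluation, since K[X] is commutative; hence [y] is sent to
    its class sum times one nonzero polynomial. *)
Lemma mem_ker_Lambda p y : p \in Q -> y \in L p -> (y \in kerc) = (class_sum p y == 0).
Proof.
move=> pQ yL; have pn := odd_composition_comp pQ.
have yD : y \in Dn by apply/(subvP peak_sub_descent)/(subvP (Lambda_sub_peak pQ)).
rewrite (mem_ker_solomon charK y (ltnSn n)) yD //=.
have -> : descent_eval n.+1 y = class_sum p y *: descent_eval n.+1 (g p).
  rewrite (Lambda_span pn yL) [LHS]bext_sum cs_sum scaler_suml; apply: eq_big_seq => t.
  rewrite mem_permutations => tp; rewrite csZ class_sum_gamma
    ?(odd_composition_perm pQ tp) //.
  by rewrite tp mulr1 -(eval_gamma_perm pn tp).
by rewrite scaler_eq0 (negPf (eval_gamma_neq0 pn)) orbF.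
Qed.

Lemma sum_odd_compositions (V : nmodType) (F : seq nat -> V) :
  \sum_(q <- Q) F q = \sum_(p <- odd_partitions n) \sum_(q <- Q | perm_eq q p) F q.
Proof.
under [RHS]eq_bigr do rewrite big_mkcond.
rewrite [RHS]exchange_big; apply: eq_big_seq => q qQ.
have qs : perm_eq q (sort geq q) by rewrite perm_sym; apply/permEl/perm_sort.
have qn := odd_composition_comp qQ.
have sP : sort geq q \in odd_partitions n.
  rewrite odd_partitionP (odd_composition_perm qQ) 1?perm_sym //=.
  exact: (sort_sorted geq_total).
rewrite (bigD1_seq _ sP) ?odd_partitions_uniq //= qs big1_seq ?addr0 // => p.
case/andP=> np pP; rewrite (permPl qs) (@perm_partition n) ?sort_partition //.
  by rewrite eq_sym (negPf np).
by move: pP; rewrite mem_filter => /andP[].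
Qed.

Definition proj p x : KS := \sum_(q <- Q | perm_eq q p) bcoef Q g q x *: g q.

Lemma sum_proj x : x \in Pn -> x = \sum_(p <- odd_partitions n) proj p x.
Proof. by move=> xP; rewrite {1}(peak_span xP) sum_odd_compositions. Qed.

Lemma proj_in p x : is_composition n p -> proj p x \in L p.
Proof. by move=> pn; apply: rpred_sum => q qp; rewrite memvZ // gamma_in_Lambda. Qed.

Lemma class_sum_proj p x : class_sum p (proj p x) = class_sum p x.
Proof.
rewrite cs_sum big_seq_cond [RHS]big_seq_cond; apply: eq_bigr => q /andP[qQ qp].
by rewrite csZ class_sum_gamma // qp mulr1.
Qed.

Lemma proj_Lambda p r x : p \in Q -> x \in L p ->
  proj r x = if perm_eq p r then x else 0.
Proof.
move=> pQ xL; have pn := odd_composition_comp pQ.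
have b0 q : ~~ perm_eq q p -> bcoef Q g q x = 0.
  move=> nqp; rewrite (Lambda_span pn xL) (functional_sum (bcoef_lin _ _ _)) big1_seq
    // => t.
  rewrite mem_permutations => /andP[_ tp].
  rewrite (functionalZ (bcoef_lin _ _ _)) bcoefE ?odd_free
    ?(odd_composition_perm pQ tp) //.
  by case: eqP => [e|]; rewrite ?mulr0 // -e tp in nqp *.
have xP := subvP (Lambda_sub_peak pQ) x xL.
case: ifP => pr.
  rewrite [RHS](peak_span xP) /proj big_mkcond; apply: eq_bigr => q _.
  by case: ifP => // qr; rewrite b0 ?scale0r // (permPr pr) qr.
rewrite /proj big1 // => q qr; rewrite b0 ?scale0r //.
by apply/negP=> qp; rewrite -(permPl qp) qr in pr.
Qed.

Lemma odd_partition_comp p : p \in odd_partitions n -> p \in Q /\ is_composition n p.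
Proof. by rewrite odd_partitionP odd_compositionP => /andP[/andP[-> ->]]. Qed.

(** The image of [x] is a combination, with the class sums as coefficients, of polynomials whose
    degrees are the weights of distinct partitions. *)
Lemma mem_ker_peak x : x \in Pn ->
  x \in kerc <-> (forall p, p \in odd_partitions n -> class_sum p x = 0).
Proof.
move=> xP; have xD := subvP peak_sub_descent x xP.
rewrite (mem_ker_solomon charK x (ltnSn n)) xD /=.
have -> : descent_eval n.+1 x =
    \sum_(p <- odd_partitions n) class_sum p x *: descent_eval n.+1 (g p).
  rewrite {1}(peak_span xP) [LHS]bext_sum sum_odd_compositions; apply: eq_big_seq => p.
  case/odd_partition_comp=> _ pn; rewrite /class_sum scaler_suml;
    apply: eq_bigr => q qp.
  by rewrite -(eval_gamma_perm pn qp).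
split=> [/eqP e|h]; last by rewrite big1_seq // => p /andP[_ /h->]; rewrite scale0r.
have wlt p : is_composition n p -> (weight n.+1 p < n.+1 ^ n.+1)%N.
  move=> pn; apply: weight_lt; first by rewrite ltnS size_composition.
  case/andP: pn => _ /eqP sp; apply/allP=> a ap /=.
  by rewrite -sp (perm_sumn (perm_to_rem ap)) leq_addr.
(* The pairing is the coefficient in degree [weight n.+1 w], which vanishes for polynomials of
   smaller degree. The rank must therefore reverse the weight; [n.+1 ^ n.+1] exceeds all weights. *)
apply: (@triangular_coef0 _ _ (odd_partitions n) (fun p => descent_eval n.+1 (g p))
  (fun w v => (descent_eval n.+1 (g v))`_(weight n.+1 w))
  (fun w => n.+1 ^ n.+1 - weight n.+1 w)%N (fun p => class_sum p x)) e.
- exact: odd_partitions_uniq.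
- move=> w _ /(congr1 (fun f : {poly K} => f`_(weight n.+1 w))).
  by rewrite coef0 coef_sum => e0; rewrite -[RHS]e0; apply: eq_bigr => v _;
    rewrite coefZ.
- move=> w /odd_partition_comp[_ wn].
  have sz := size_descent_eval_word charK gammaLie (ltnSn n) wn.
  by have := eval_gamma_neq0 wn; rewrite -lead_coef_eq0 lead_coefE sz.
move=> w v wP vP nwv; have [_ wn] := odd_partition_comp wP.
have [_ vn] := odd_partition_comp vP.
have sz := size_descent_eval_word charK gammaLie (ltnSn n) vn.
have [le|lt] := leqP (weight n.+1 w) (weight n.+1 v); last first.
  by rewrite nth_default ?eqxx // sz.
move=> _; apply: ltn_sub2l; first exact: wlt.
rewrite ltn_neqAle le andbT; apply: contraNneq nwv => ew; apply/eqP.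
by apply: weight_inj ew; rewrite ?ltnS ?size_composition //; move: wP vP;
  rewrite !odd_partitionP => /andP[_ ?] /andP[_ ?].
Qed.

(* A submodule of Lambda^p containing an element of nonzero class sum is
   everything, so the class sum zero part is the unique maximal submodule. *)
Lemma Rad_Lambda (A : {vspace KS}) p : p \in Q -> (A <= Dn)%VS -> (L p <= A)%VS ->
  Rad_mod A (L p) = (kerc :&: L p)%VS.
Proof.
move=> pQ AD LA; have pn := odd_composition_comp pQ.
set N := (kerc :&: L p)%VS.
have NP y : (y \in N) = (y \in L p) && (class_sum p y == 0).
  rewrite memv_cap andbC; case: (boolP (y \in L p)) => //= yL.
  exact: mem_ker_Lambda.
have subN : submodule A (L p) N.
  split; first exact: capvSr.
  apply/prodvP=> x y /(subvP AD) xD; rewrite !NP => /andP[yL /eqP y0].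
  rewrite descent_mul_Lambda // class_sum_mul ?y0 ?mulr0 ?eqxx //.
  exact: subvP (Lambda_sub_peak pQ) y yL.
have gpL : g p \in L p by apply: gamma_in_Lambda.
have NneqL : N <> L p.
  move=> e; move: gpL; rewrite -e NP class_sum_gamma // perm_refl => /andP[_].
  by rewrite oner_eq0.
(* The product gamma_t u is a nonzero multiple of gamma_t for each t ~ p. It belongs to [U] because
   gamma_t is in Lambda^p and so in [A]. *)
have big U u : submodule A (L p) U -> u \in U -> class_sum p u != 0 -> U = L p.
  move=> [UL AU] uU u0; apply/eqP; rewrite eqEsubv UL /= [X in (X <= _)%VS]LambdaE //.
  apply/span_subvP => z /mapP[t]; rewrite mem_permutations => tp ->.
  have := gamma_mul_Lambda pQ tp (subvP UL u uU).
  move/(congr1 (fun z => (gamma_norm gamma t * class_sum p u)^-1 *: z)).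
  rewrite scalerA mulVf ?scale1r => [<-|].
    rewrite memvZ // (subvP AU) // memv_mul // (subvP LA) //.
    exact: gamma_in_Lambda.
  rewrite mulf_neq0 // gamma_norm_neq0 //.
  by case/andP: (composition_perm pn tp).
have proper U : submodule A (L p) U -> U <> L p -> (U <= N)%VS.
  move=> sU nU; apply/subvP=> u uU; rewrite NP (subvP sU.1) //=.
  by apply: contra_notT nU; apply: big sU uU.
have maxN : maximal_submodule A (L p) N.
  split=> // U sU NU; have [->|/eqP nU] := eqVneq U (L p); first by right.
  by left; apply/eqP; rewrite eqEsubv NU proper.
apply/vspaceP=> v; rewrite memv_cap; apply/idP/idP => [/andP[_ /memv_bigcap]|vN].
  exact.
rewrite (subvP subN.1 v vN) /=; apply/memv_bigcap => U [sU nU maxU].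
by case: (maxU N subN (proper U sU nU)) => [<-|/NneqL].
Qed.

(** * The radical of the peak algebra *)

Lemma Rad_peak : Rad Pn = (Pn :&: kerc)%VS.
Proof.
apply/vspaceP=> x; rewrite [LHS]memv_cap [RHS]memv_cap; apply/andP/andP => -[xP xK];
  split=> //.
  apply/(mem_ker_peak xP) => p /odd_partition_comp[pQ pn].
  (* The kernel of a nonzero functional is maximal even as a subspace, and by [class_sum_mul] it is
     a submodule. *)
  pose M := (Pn :&: lker (linfun (class_sum p : KS -> K^o)))%VS.
  have MP y : (y \in M) = (y \in Pn) && (class_sum p y == 0).
    by rewrite memv_cap memv_ker lfunE.
  have gpP : g p \in Pn by apply: (gamma_word_peak gammaLie gammaPeak).
  have maxM : maximal_submodule Pn Pn M.
    split.
    - split; first exact: capvSl.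
      apply/prodvP=> y z yP; rewrite !MP => /andP[zP /eqP z0].
      have yD := subvP peak_sub_descent y yP.
      by rewrite peak_mul // class_sum_mul // z0 mulr0 eqxx.
    - move=> e; move: gpP; rewrite -{1}e MP class_sum_gamma // perm_refl.
      by rewrite oner_eq0 andbF.
    move=> U [UP _] MU; have [UM|/subvPn[u uU uM]] := boolP (U <= M)%VS.
      by left; apply/eqP; rewrite eqEsubv UM MU.
    right; apply/eqP; rewrite eqEsubv UP /=; apply/subvP=> y yP.
    have u0 : class_sum p u != 0 by move: uM; rewrite MP (subvP UP).
    rewrite -[y](subrK ((class_sum p y / class_sum p u) *: u)).
    rewrite memvD ?memvZ // (subvP MU) // MP memvB ?memvZ //=;
      last exact: subvP UP u uU.
    by rewrite linearB /= csZ mulfVK // subrr.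
  have /memv_bigcap/(_ M maxM) := xK.
  by rewrite MP => /andP[_ /eqP].
apply/memv_bigcap => U [[UP AU] nU maxU].
rewrite (sum_proj xP) big_seq; apply: rpred_sum => p pP.
have [pQ pn] := odd_partition_comp pP.
pose N := (kerc :&: L p)%VS.
have NR : N = Rad_mod Dn (L p).
  by rewrite Rad_Lambda // (subv_trans (Lambda_sub_peak pQ)) // peak_sub_descent.
have pxN : proj p x \in N.
  rewrite memv_cap proj_in // andbT (mem_ker_Lambda pQ (proj_in x pn)) class_sum_proj.
  by rewrite ((mem_ker_peak xP).1 xK p pP).
apply: (subvP (_ : (N <= U)%VS)) pxN.
have sub : submodule Pn Pn (U + N)%VS.
  split; first by rewrite subv_add UP (subv_trans (capvSr _ _)) // Lambda_sub_peak.
  rewrite prodvDr subv_add (subv_trans AU) ?addvSl //=.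
  apply: subv_trans (addvSr _ _); apply/prodvP=> y z yP.
  rewrite !(memv_cap _ kerc) => /andP[zk zL]; have yD := subvP peak_sub_descent y yP.
  rewrite (mem_ker_Lambda pQ zL) in zk; have yzL : y * z \in L p by apply:
    descent_mul_Lambda.
  rewrite yzL (mem_ker_Lambda pQ yzL) class_sum_mul ?(eqP zk) ?mulr0 ?eqxx //.
  exact: subvP (Lambda_sub_peak pQ) z zL.
case: (maxU _ sub (addvSl _ _)) => [e|e]; first by rewrite -e addvSr.
(* In the remaining case gamma_p = u + v with v of class sum 0. Then u has class sum 1, and its
   products with the gamma_t, t ~ p, show that [U] contains Lambda^p. *)
have : g p \in (U + N)%VS by rewrite e; apply: (gamma_word_peak gammaLie gammaPeak).
case/memv_addP=> u uU [v vN gpe].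
apply: (subv_trans (capvSr _ _)); rewrite LambdaE //.
have vL : v \in L p by move: vN; rewrite memv_cap => /andP[].
have uE : u = g p - v by rewrite gpe addrK.
have uL : u \in L p by rewrite uE memvB // gamma_in_Lambda.
have cu : class_sum p u = 1.
  move: vN; rewrite memv_cap (mem_ker_Lambda pQ vL) => /andP[/eqP v0 _].
  by rewrite uE linearB /= v0 subr0 class_sum_gamma // perm_refl.
apply/span_subvP => z /mapP[t]; rewrite mem_permutations => tp ->.
have t0 : gamma_norm gamma t != 0.
  by rewrite gamma_norm_neq0 //; case/andP: (composition_perm pn tp).
have := gamma_mul_Lambda pQ tp uL; rewrite cu mulr1.
move/(congr1 (fun z => (gamma_norm gamma t)^-1 *: z));
  rewrite scalerA mulVf // scale1r => <-.
rewrite memvZ // (subvP AU) // memv_mul // (subvP (Lambda_sub_peak pQ)) //.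
exact: gamma_in_Lambda.
Qed.

Lemma mem_ker_proj x p : x \in (Pn :&: kerc)%VS -> p \in odd_partitions n ->
  proj p x \in (kerc :&: L p)%VS.
Proof.
rewrite [_ \in _]memv_cap => /andP[xP xk] pP; have [pQ pn] := odd_partition_comp pP.
rewrite [_ \in _]memv_cap proj_in // andbT (mem_ker_Lambda pQ (proj_in x pn))
  class_sum_proj.
by rewrite ((mem_ker_peak xP).1 xk p pP).
Qed.

Lemma ker_Lambda_sub p : p \in odd_partitions n -> (kerc :&: L p <= Pn :&: kerc)%VS.
Proof.
case/odd_partition_comp=> pQ _; rewrite subv_cap capvSl andbT.
exact: subv_trans (capvSr _ _) (Lambda_sub_peak pQ).
Qed.

Lemma Rad_peak_sum : Rad Pn = (\sum_(p <- odd_partitions n) (kerc :&: L p))%VS.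
Proof.
rewrite Rad_peak; apply/eqP; rewrite eqEsubv; apply/andP; split.
  apply/subvP=> x xR; have xP : x \in Pn by move: xR;
    rewrite [_ \in _]memv_cap => /andP[].
  by rewrite (sum_proj xP); apply: memv_sum_seq => p; apply: mem_ker_proj.
rewrite big_seq; elim/big_rec: _ => [|p U pP UP]; first exact: sub0v.
by rewrite subv_add UP ker_Lambda_sub.
Qed.

Lemma Lambda_independent (v : seq nat -> KS) :
  (forall p, p \in odd_partitions n -> v p \in L p) ->
  \sum_(p <- odd_partitions n) v p = 0 -> forall p, p \in odd_partitions n -> v p = 0.
Proof.
move=> vL v0 p pP.
have : proj p (\sum_(r <- odd_partitions n) v r) = v p.
  rewrite {1}/proj; under eq_bigr do rewrite (functional_sum (bcoef_lin _ _ _))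
    scaler_suml.
  rewrite exchange_big (bigD1_seq p) ?odd_partitions_uniq //= [X in _ + X]big1_seq =>
    [|r /andP[nrp rP]].
    by rewrite addr0 -/(proj p _) (proj_Lambda _ (odd_partition_comp pP).1 (vL p pP))
      perm_refl.
  rewrite -/(proj p _) (proj_Lambda _ (odd_partition_comp rP).1 (vL r rP)).
  by rewrite (@perm_partition n) ?(negPf nrp) //; [move: rP | move: pP];
    rewrite mem_filter => /andP[].
rewrite v0 => <-; rewrite /proj big1 // => q _.
by rewrite (functional0 (bcoef_lin _ _ _)) scale0r.
Qed.

Lemma Rad_peak_span : Rad Pn =
  <<[seq g q - g p | p <- odd_partitions n, q <- permutations p]>>%VS.
Proof.
apply/eqP; rewrite eqEsubv; apply/andP; split; last first.
  apply/span_subvP => _ /allpairsPdep[p [q [pP qp ->]]]; rewrite mem_permutations in qp.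
  have [pQ pn] := odd_partition_comp pP; rewrite Rad_peak (subvP (ker_Lambda_sub pP))
    //.
  have dL : g q - g p \in L p by rewrite memvB // gamma_in_Lambda.
  rewrite [_ \in _]memv_cap dL (mem_ker_Lambda pQ dL) linearB /=.
  by rewrite !class_sum_gamma ?(odd_composition_perm pQ qp) // qp perm_refl subrr eqxx.
rewrite Rad_peak_sum big_seq; elim/big_rec: _ => [|p U pP UP]; first exact: sub0v.
rewrite subv_add UP andbT; apply/subvP=> x; have [pQ pn] := odd_partition_comp pP.
rewrite [_ \in _]memv_cap => /andP[xk xL].
rewrite (mem_ker_Lambda pQ xL) (Lambda_span pn xL) cs_sum in xk.
have x0 : \sum_(q <- permutations p) bcoef (permutations p) g q x = 0.
  rewrite -[RHS](eqP xk); apply: eq_big_seq => q; rewrite mem_permutations => qp.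
  by rewrite csZ class_sum_gamma ?(odd_composition_perm pQ qp) // qp mulr1.
(* The coefficients sum to 0, so subtracting gamma_p from every gamma_q changes nothing. *)
have -> : x = \sum_(q <- permutations p) bcoef (permutations p) g q x *: (g q - g p).
  under eq_bigr do rewrite scalerBr.
  by rewrite sumrB -scaler_suml x0 scale0r subr0 -(Lambda_span pn xL).
rewrite big_seq; apply: rpred_sum => q qp; rewrite memvZ // memv_span //.
by apply/allpairsPdep; exists p, q.
Qed.

(** On P_n the character is a multiple of the class sum, so the class sum of a product is symmetric
    in its two factors. *)
Lemma commutator_in_Rad x y : x \in Pn -> y \in Pn -> x * y - y * x \in Rad Pn.
Proof.
move=> xP yP; have [xD yD] := (subvP peak_sub_descent x xP, subvP peak_sub_descent y
  yP).
have cP : x * y - y * x \in Pn by rewrite memvB // peak_mul.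
rewrite Rad_peak [_ \in _]memv_cap cP; apply/(mem_ker_peak cP) => p
  /odd_partition_comp[pQ _].
by rewrite linearB /= !class_sum_mul // !class_charE // mulrAC subrr.
Qed.

(** The gamma_p, p an odd partition, are dual to the class sums and therefore span a complement of
    their common kernel. *)
Lemma dim_peak_Rad : (\dim Pn - \dim (Rad Pn))%N = size (odd_partitions n).
Proof.
pose S := <<map g (odd_partitions n)>>%VS.
have cs p r : p \in odd_partitions n -> r \in odd_partitions n ->
    class_sum r (g p) = (p == r)%:R.
  move=> pP rP; rewrite class_sum_gamma ?(odd_partition_comp pP).1 //.
  by rewrite (@perm_partition n) //; [move: pP | move: rP];
    rewrite mem_filter => /andP[].
have csS (c : seq nat -> K) r : r \in odd_partitions n ->
    class_sum r (\sum_(p <- odd_partitions n) c p *: g p) = c r.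
  move=> rP; rewrite cs_sum (bigD1_seq r) ?odd_partitions_uniq //= big1_seq =>
    [|p /andP[npr pP]].
    by rewrite addr0 csZ cs // eqxx mulr1.
  by rewrite csZ cs // (negPf npr) mulr0.
have dS : \dim S = size (odd_partitions n).
  rewrite -(size_map g); apply/eqP; apply: free_map => [|c c0 r rP].
    exact: odd_partitions_uniq.
  by rewrite -(csS c) // c0 cs0.
have SP : (S <= Pn)%VS.
  apply/span_subvP => _ /mapP[p pP ->]; apply: (gamma_word_peak gammaLie gammaPeak).
  by case/odd_partition_comp: pP.
have RS : Pn = (Rad Pn + S)%VS.
  apply/eqP; rewrite eqEsubv subv_add SP andbT; apply/andP; split;
    last by rewrite Rad_peak capvSl.
  apply/subvP=> x xP; pose s := \sum_(p <- odd_partitions n) class_sum p x *: g p.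
  have sS : s \in S.
    by rewrite /s big_seq; apply: rpred_sum => p pP;
      rewrite memvZ // memv_span // map_f.
  rewrite -[x](subrK s) memv_add // Rad_peak [_ \in _]memv_cap.
  have dP : x - s \in Pn by rewrite memvB // (subvP SP).
  rewrite dP; apply/(mem_ker_peak dP) => p pP.
  by rewrite linearB /= csS // subrr.
have cap0 : (Rad Pn :&: S = 0)%VS.
  apply/eqP; rewrite -subv0; apply/subvP=> x; rewrite [_ \in _]memv_cap Rad_peak.
  rewrite [X in X && _]memv_cap memv0 => /andP[/andP[xP xk] xS].
  rewrite (bcoef_sum odd_partitions_uniq xS) big1_seq // => p /andP[_ pP].
  rewrite -[bcoef _ _ _ _](csS (fun p => bcoef (odd_partitions n) g p x)) //.
  by rewrite -(bcoef_sum odd_partitions_uniq xS) ((mem_ker_peak xP).1 xk p pP) scale0r.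
by rewrite {1}RS dimv_disjoint_sum // addKn dS.
Qed.

End Radicals.

Theorem corollary10p3 (K : fieldType) (charK : [pchar K] =i pred0)
    (n : nat) (n_gt0 : (0 < n)%N)
    (gamma : forall m : nat, galg K 'S_m)
    (gammaLie : Lie_series gamma)
    (gammaPeak : forall m : nat, odd m -> gamma m \in peak_alg K m) :
  let Dn := descent_alg K n in
  let Pn := peak_alg K n in
  let kerc := ker_solomon K n in
  let Lambda (p : seq nat) := (Dn * <[gamma_word gamma n p]>)%VS in
  (forall p : seq nat, p \in odd_partitions n ->
     Rad_mod Pn (Lambda p) = (kerc :&: Lambda p)%VS
     /\ (kerc :&: Lambda p)%VS = Rad_mod Dn (Lambda p))
  /\ directv (\sum_(p <- odd_partitions n) Rad_mod Pn (Lambda p))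
  /\ Rad Pn = (\sum_(p <- odd_partitions n) Rad_mod Pn (Lambda p))%VS
  /\ Rad Pn = (Pn :&: kerc)%VS
  /\ Rad Pn = <<[seq gamma_word gamma n q - gamma_word gamma n p
                | p <- odd_partitions n, q <- permutations p]>>%VS
  /\ (forall x y : galg K 'S_n, x \in Pn -> y \in Pn -> x * y - y * x \in Rad Pn)
  /\ (\dim Pn - \dim (Rad Pn))%N = size (odd_partitions n).
Proof.
move=> Dn Pn kerc Lambda.
(* Stated for every [A] between P_n and D_n, so that it covers both radicals. *)
have RadL A p : p \in odd_partitions n -> (A <= Dn)%VS -> (Pn <= A)%VS ->
    Rad_mod A (Lambda p) = (kerc :&: Lambda p)%VS.
  case/odd_partition_comp=> pQ _ AD PA; apply: Rad_Lambda => //.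
  exact: subv_trans (Lambda_sub_peak charK gammaLie gammaPeak pQ) PA.
have PD := peak_sub_descent charK gammaLie gammaPeak n_gt0.
split; first by move=> p pP; rewrite !RadL.
split.
  apply: directv_seq => [|v vN]; first exact: odd_partitions_uniq.
  apply: (Lambda_independent charK gammaLie gammaPeak n_gt0) => p pP.
  by have := vN p pP; rewrite RadL // [_ \in _]memv_cap => /andP[].
split.
  rewrite (Rad_peak_sum charK gammaLie gammaPeak n_gt0).
  by apply: eq_big_seq => p pP; rewrite RadL.
split; first exact: (Rad_peak charK gammaLie gammaPeak).
split; first exact: (Rad_peak_span charK gammaLie gammaPeak).
split; first exact: (commutator_in_Rad charK gammaLie gammaPeak).
exact: (dim_peak_Rad charK gammaLie gammaPeak).
Qed.
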